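(* Let $n\ge2$ and let $G$ be the free group on $u_1,\dots,u_n$. Let $p$ be a nonzero polynomial with complex coefficients, and let $\psi$ be a reduced state of $G$ such that $\psi(|p(u_1)|^2)=0$, where $|p(u_1)|^2=p(u_1)^*p(u_1)$. Then $\psi$ must be a convex combination of states $\chi_z$ for $z$'s among the zeros of $p$ on the unit circle. Said another way, the only representations $\pi$ of $G$ weakly contained in the left regular representation such that $\pi(p(u_1))$ has a nonzero kernel are direct sums of representations $\pi_z$ (with $|z|=1$ and $p(z)=0$).
   Context: A state on $G$ is a positive definite function with value $1$ at the identity, extended linearly to the complex group algebra $\mathbb{C}G$ (with $s^*=s^{-1}$ for $s\in G$). It is reduced if it extends to a positive linear functional on the reduced C*-algebra $C^*_r(G)$, the operator-norm closure of the image of $\mathbb{C}G$ under the left regular representation on $\ell^2(G)$; equivalently, its associated (GNS) unitary representation is weakly contained in the left regular representation. Representations of $G$ are unitary representations on Hilbert space, extended linearly to $\mathbb{C}G$. Let $G_1$ be the subgroup of $G$ generated by $u_1$. For a complex number $z$ with $|z|=1$, $\chi_z$ is the (reduced) state on $G$ with $\chi_z(u_1^j)=z^j$ for all $j\in\mathbb{Z}$ and $\chi_z(s)=0$ for $s\in G\setminus G_1$; $\pi_z$ is the unitary representation of $G$ constructed from $\chi_z$ by the GNS construction.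
   Formalization: The second sentence fails for the direct sum of the left regular representation and some π_z with p(z)=0; it is proved instead that the subrepresentation generated by the kernel of π(p(u_1)) is a direct sum of representations π_z, which is all of π when the kernel generates it. *)

(* Defs.v *)
From HB Require Import structures.
From mathcomp Require Import all_boot all_order all_algebra.
From mathcomp Require Import sesquilinear complex finmap.
From mathcomp Require Import all_classical all_reals all_analysis.
From mathcomp Require Import ring.
From mathcomp Require summability.
Import Order.TTheory GRing.Theory Num.Theory numFieldNormedType.Exports.
Set Implicit Arguments.
Unset Strict Implicit.
Unset Printing Implicit Defensive.
Local Open Scope classical_set_scope.
Local Open Scope ring_scope.
#[local] Existing Instance summability.totally_filter.
Local Notation totally := summability.totally.
Local Notation psum := summability.partial_sum.

Lemma parallelogram (C : numClosedFieldType) (a b : C) :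
  `|a + b| ^+ 2 = 2 * (`|a| ^+ 2 + `|b| ^+ 2) - `|a - b| ^+ 2.
Proof. rewrite !normCK rmorphB rmorphD/=; ring. Qed.

Lemma polarization (C : numClosedFieldType) (a b : C) :
  a * b^* = 4^-1 * (`|a + b| ^+ 2 - `|a - b| ^+ 2)
    + 4^-1 * 'i * (`|a + 'i * b| ^+ 2 - `|a - 'i * b| ^+ 2).
Proof.
rewrite !normCK !rmorphB !rmorphD !rmorphM/= conjCi.
have i2 : 'i * 'i = -1 :> C by rewrite -expr2 sqrCi.
rewrite [in RHS](_ : _ + _ = 4^-1 * (4 * (a * b^*)) + 2^-1 * (1 + 'i * 'i) * (a^* * b - a * b^*)).
  by rewrite mulKf ?pnatr_eq0// i2 subrr mulr0 mul0r addr0.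
by field.
Qed.

Section Sums.
Variables (R : realType) (T : choiceType).
Local Notation C := R[i].
Implicit Types f g h : T -> C^o.

Lemma psumE f (A : {fset T}) : psum f A = \sum_(x <- A) f x.
Proof. by rewrite /psum big_seq_fsetE. Qed.

Lemma psum_le f (A B : {fset T}) : (forall x, 0 <= f x) -> (A `<=` B)%fset ->
  psum f A <= psum f B.
Proof.
move=> f0 AB; rewrite !psumE (big_fsetID _ (mem A) B) /=.
have -> : [fset x in B | x \in A]%fset = A.
  apply/fsetP => x; rewrite !inE /= andbC.
  by case: (boolP (x \in A)) => //= /(fsubsetP AB).
by rewrite lerDl sumr_ge0.
Qed.

Lemma nonneg_sum f M : (forall x, 0 <= f x) -> (forall A, psum f A <= M) ->
  exists l : C^o, [/\ psum f @ totally --> l, forall A, psum f A <= l &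
    forall N, (forall A, psum f A <= N) -> l <= N].
Proof.
move=> f0 fM; pose S := [set complex.Re (psum f A) | A in setT].
have p0 A : 0 <= psum f A by rewrite psumE sumr_ge0.
have toR (z : C) : 0 <= z -> z = (complex.Re z)%:C%C.
  by move=> /ger0_Im; case: z => a b /= ->.
have supS : has_sup S.
  split; first by exists (complex.Re (psum f fset0)), fset0.
  exists (complex.Re M) => _ [A _ <-]; have := fM A.
  by rewrite lecE => /andP[].
have ub A : psum f A <= (sup S)%:C%C.
  rewrite (toR _ (p0 A)) lecR; apply: ub_le_sup; first by case: supS.
  by exists A.
exists (sup S)%:C%C; split => //; last first.
  move=> N HN; have N0 : 0 <= N by exact: le_trans (p0 fset0) (HN _).
  rewrite (toR _ N0) lecR; apply: ge_sup; first by case: supS.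
  by move=> _ [A _ <-]; have := HN A; rewrite lecE => /andP[].
apply/cvgrPdist_lt => e e0.
have eR := toR _ (ltW e0); have e0' : 0 < complex.Re e by rewrite -ltcR -eR.
have [_ [A _ <-] HA] := sup_adherent e0' supS.
exists A => // B /= AB.
rewrite ger0_norm ?subr_ge0// ltrBlDr addrC -ltrBlDr.
apply: lt_le_trans (psum_le f0 AB).
by rewrite {1}eR -rmorphB (toR _ (p0 A)) ltcR.
Qed.

Definition sqsum (f : T -> C) :=
  exists M : C, forall A : {fset T}, psum (fun x => `|f x| ^+ 2) A <= M.

Lemma sqsum_sum f : sqsum f -> exists l : C^o,
  [/\ psum (fun x => `|f x| ^+ 2 : C^o) @ totally --> l,
      forall A, psum (fun x => `|f x| ^+ 2 : C^o) A <= l &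
      forall N, (forall A, psum (fun x => `|f x| ^+ 2 : C^o) A <= N) ->
        l <= N].
Proof. by case=> M HM; apply: (@nonneg_sum _ M) => // x; rewrite exprn_ge0. Qed.

Lemma sqsumD (f g : T -> C) : sqsum f -> sqsum g -> sqsum (f + g).
Proof.
move=> [M HM] [N HN]; exists (2 * (M + N)) => A.
have : psum (fun x => `|(f + g) x| ^+ 2) A <=
    2 * (psum (fun x => `|f x| ^+ 2) A + psum (fun x => `|g x| ^+ 2) A).
  rewrite !psumE -big_split mulr_sumr; apply: ler_sum => x _ /=.
  have -> : `|(f + g) x| ^+ 2 = 2 * (`|f x|^+2 + `|g x|^+2) - `|f x - g x| ^+ 2.
    exact: parallelogram.
  by rewrite gerBl exprn_ge0.
by move/le_trans; apply; rewrite ler_pM2l// lerD.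
Qed.

Lemma sqsumZ a (f : T -> C) : sqsum f -> sqsum (a *: f).
Proof.
move=> [M HM]; exists (`|a| ^+ 2 * M) => A.
have -> : psum (fun x => `|(a *: f) x| ^+ 2) A =
    `|a| ^+ 2 * psum (fun x => `|f x| ^+ 2) A.
  by rewrite !psumE mulr_sumr; apply: eq_bigr => x _; rewrite normrM exprMn.
by rewrite ler_wpM2l// exprn_ge0.
Qed.
End Sums.

Section L2.
Variables (R : realType) (T : choiceType).
Local Notation C := R[i].

Definition sqsummable : {pred T -> C} := mem [set f | @sqsum R T f].

Lemma sqsummableP f : reflect (sqsum f) (f \in sqsummable).
Proof. by apply: (iffP idP) => [/set_mem|/mem_set]. Qed.

Fact sqsummable_submod_closed : submod_closed sqsummable.
Proof.
split.
  apply/sqsummableP; exists 0 => A.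
  by rewrite psumE big1// => x _; rewrite normr0 expr0n.
move=> a f g /sqsummableP fS /sqsummableP gS; apply/sqsummableP/sqsumD => //.
exact: sqsumZ.
Qed.
HB.instance Definition _ := GRing.isSubmodClosed.Build C (T -> C) sqsummable
  sqsummable_submod_closed.

Record l2 := L2 { l2val :> T -> C; l2P : l2val \in sqsummable }.
HB.instance Definition _ := [isSub for l2val].
HB.instance Definition _ := [Choice of l2 by <:].
HB.instance Definition _ := [SubChoice_isSubLmodule of l2 by <:].

Implicit Types f g h : l2.

(* The sum is the limit over the finite subsets of [T] ordered by inclusion. *)
Definition l2dot f g : C := summability.sum (fun x => f x * (g x)^* : C^o).

Lemma l2DE f g x : (f + g) x = f x + g x. Proof. by []. Qed.
Lemma l2ZE a f x : (a *: f) x = a * f x. Proof. by []. Qed.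
Lemma l2NE f x : (- f) x = - f x. Proof. by []. Qed.

Lemma l2_sqsum f : sqsum f. Proof. exact/sqsummableP/l2P. Qed.

Lemma l2dot_cvg f g :
  psum (fun x => f x * (g x)^* : C^o) @ totally --> (l2dot f g : C^o).
Proof.
suff H : cvg (psum (fun x => f x * (g x)^* : C^o) @ totally) by [].
have N u : cvg (psum (fun x => `|l2val u x| ^+ 2 : C^o) @ totally).
  by have [l [? _ _]] := sqsum_sum (l2_sqsum u); apply/cvg_ex; exists l.
have -> : psum (fun x => f x * (g x)^* : C^o) =
    4^-1 *: (psum (fun x => `|l2val (f + g) x| ^+ 2 : C^o)
             - psum (fun x => `|l2val (f - g) x| ^+ 2 : C^o))
    + (4^-1 * 'i) *: (psum (fun x => `|l2val (f + 'i *: g) x| ^+ 2 : C^o)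
                      - psum (fun x => `|l2val (f - 'i *: g) x| ^+ 2 : C^o)).
  apply/funext => A.
  rewrite [RHS](_ : _ =
    4^-1 * (psum (fun x => `|l2val (f + g) x| ^+ 2) A
            - psum (fun x => `|l2val (f - g) x| ^+ 2) A)
    + (4^-1 * 'i) * (psum (fun x => `|l2val (f + 'i *: g) x| ^+ 2) A
                     - psum (fun x => `|l2val (f - 'i *: g) x| ^+ 2) A))//.
  rewrite !psumE -!sumrB !mulr_sumr -big_split; apply: eq_bigr => x _ /=.
  exact: polarization.
by apply: is_cvgD; apply: is_cvgZr; apply: is_cvgB; apply: N.
Qed.

Lemma l2dot_unique f g (l : C^o) :
  psum (fun x => f x * (g x)^* : C^o) @ totally --> l -> l2dot f g = l.
Proof. by move=> H; apply: cvg_lim H; apply: norm_hausdorff. Qed.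

Lemma l2dot_linear (u : l2) : GRing.linear_for *%R (l2dot^~ u).
Proof.
move=> a f g; apply: l2dot_unique.
rewrite [X in X @ _ --> _](_ : _ = a *: psum (fun x => f x * (u x)^* : C^o)
    + psum (fun x => g x * (u x)^* : C^o)).
  by apply: cvgD; [apply: cvgZr|]; apply: l2dot_cvg.
apply/funext => A; rewrite [RHS](_ : _ = a * psum (fun x => f x * (u x)^*) A
    + psum (fun x => g x * (u x)^*) A)//.
rewrite !psumE mulr_sumr -big_split; apply: eq_bigr => x _ /=.
by rewrite [X in X * _ = _](_ : _ = a * f x + g x)// mulrDl mulrA.
Qed.

Lemma l2dotC f g : l2dot f g = (l2dot g f)^*.
Proof.
apply: l2dot_unique; apply/cvgrPdist_lt => e e0.
have /cvgrPdist_lt/(_ _ e0) := @l2dot_cvg g f.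
apply: filterS => A /=; rewrite -[X in X < e -> _]norm_conjC rmorphB/= !psumE.
rewrite rmorph_sum; congr (`|_ - _| < _); apply: eq_bigr => x _ /=.
by rewrite rmorphM/= conjCK mulrC.
Qed.

Lemma l2dot_spec f : (forall A, psum (fun x => `|f x| ^+ 2) A <= l2dot f f) /\
  (forall N, (forall A, psum (fun x => `|f x| ^+ 2) A <= N) -> l2dot f f <= N).
Proof.
have [l [fl lub lmin]] := sqsum_sum (l2_sqsum f).
suff -> : l2dot f f = l by [].
apply: l2dot_unique; rewrite [X in X @ _ --> _](_ : _ = psum (fun x => `|f x| ^+ 2 : C^o))//.
by apply/funext => A; rewrite !psumE; apply: eq_bigr => x _; rewrite normCK.
Qed.

Lemma l2dot_gt0 f : f != 0 -> 0 < l2dot f f.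
Proof.
move=> fN0; have [ub _] := l2dot_spec f.
have [x fx] : exists x, f x != 0.
  apply: contra_neqP fN0 => /forallNP H; apply/val_inj/funext => x /=.
  by apply/eqP; move: (H x) => /negP; rewrite negbK.
apply: lt_le_trans (ub [fset x]%fset).
by rewrite psumE big_seq_fset1 exprn_gt0 ?normr_gt0.
Qed.

Lemma l2dot_bilinear : bilinear_for *%R (Num.conj \; *%R) l2dot.
Proof.
split; first exact: l2dot_linear.
move=> u a f g /=; rewrite l2dotC l2dot_linear rmorphD rmorphM/=.
by rewrite -!l2dotC.
Qed.

HB.instance Definition _ := @bilinear_isBilinear.Build C l2 l2 C *%R
  (Num.conj \; *%R) l2dot l2dot_bilinear.
Fact l2dot_hermitian f g : l2dot f g = (-1) ^+ false * (l2dot g f)^*.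
Proof. by rewrite mul1r l2dotC. Qed.
HB.instance Definition _ :=
  @isHermitianSesquilinear.Build C l2 false Num.conj l2dot l2dot_hermitian.
HB.instance Definition _ := @isDotProduct.Build C l2 l2dot l2dot_gt0.
End L2.

Section CauchySchwarz.
Variables (C : numClosedFieldType) (U : lmodType C) (form : {dot U for Num.conj}).
Local Notation "''[' u , v ]" := (form u v) : ring_scope.

Lemma dot_CS u v : `|'[u, v]| ^+ 2 <= '[u, u] * '[v, v].
Proof.
have [->|v0] := eqVneq v 0; first by rewrite linear0r normr0 expr0n mulr_ge0 ?dnorm_ge0.
have vv : 0 < '[v, v] by rewrite neq0_dnorm_gt0.
pose a := '[u, v] / '[v, v].
have := dnorm_ge0 form (u - a *: v).
have E x : (a^* * x)^* = a * x^* by rewrite rmorphM/= conjCK.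
rewrite dnormB dnormZ linearZr_LR /= E.
have vvr : '[v, v]^* = '[v, v] by apply: CrealP; rewrite ger0_real ?ltW.
have aC : a^* = '[u, v]^* / '[v, v] by rewrite rmorphM/= fmorphV/= vvr.
rewrite !normCK aC /a -(ler_pM2r vv) mul0r.
move: ('[u, u]) ('[u, v]) ('[v, v]) vv => w x y y0 H; rewrite -subr_ge0.
apply: le_trans H _; rewrite le_eqVlt; apply/orP; left; apply/eqP.
by move: x^* => z; field; rewrite gt_eqF.
Qed.

Lemma dot_triangle u v :
  sqrtC '[u + v, u + v] <= sqrtC '[u, u] + sqrtC '[v, v].
Proof.
have ge := dnorm_ge0 form.
rewrite -(@ler_pXn2r _ 2) ?nnegrE ?addr_ge0 ?sqrtC_ge0 ?ge// sqrtCK sqrrD !sqrtCK.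
rewrite dnormD [leRHS]addrAC lerD2l -sqrtCM ?nnegrE ?ge//.
have [x0|] := boolP ('[u, v] + '[u, v]^* <= 0).
  by apply: le_trans x0 _; rewrite mulrn_wge0// sqrtC_ge0 mulr_ge0.
have H : `|'[u, v]| <= sqrtC ('[u, u] * '[v, v]).
  rewrite -(@ler_pXn2r _ 2) ?nnegrE ?sqrtC_ge0 ?mulr_ge0 ?ge// sqrtCK.
  exact: dot_CS.
move=> _; apply: (@le_trans _ _ (`|'[u, v]| *+ 2)); last by rewrite lerMn2r.
have := normr_ge0 ('[u, v] + '[u, v]^*) => _.
have r : '[u, v] + '[u, v]^* \is Num.real.
  by apply/CrealP; rewrite rmorphD/= conjCK addrC.
apply: le_trans (real_ler_norm r) _.
by apply: le_trans (ler_normD _ _) _; rewrite norm_conjC mulr2n.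
Qed.
End CauchySchwarz.

Section L2norm.
Variables (R : realType) (T : choiceType).
Local Notation C := R[i].
Local Notation l2 := (l2 R T).
Implicit Types f g : l2.

Definition l2norm f : C := sqrtC (l2dot f f).

Let ge0 f : 0 <= l2dot f f. Proof. exact: (dnorm_ge0 (@l2dot R T)). Qed.

Fact l2normD f g : l2norm (f + g) <= l2norm f + l2norm g.
Proof. exact: dot_triangle. Qed.

Fact l2normZ (a : C) f : l2norm (a *: f) = `|a| * l2norm f.
Proof.
rewrite /l2norm dnormZ sqrtCM ?nnegrE ?exprn_ge0// sqrCK//.
Qed.

Fact l2norm_eq0 f : l2norm f = 0 -> f = 0.
Proof. by move/eqP; rewrite sqrtC_eq0 dnorm_eq0 => /eqP. Qed.

HB.instance Definition _ :=
  @Lmodule_isNormed.Build C l2 l2norm l2normD l2normZ l2norm_eq0.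

Lemma l2_normE f : `|f| = sqrtC (l2dot f f). Proof. by []. Qed.

Lemma psum_le_norm f A : psum (fun x => `|f x| ^+ 2) A <= `|f| ^+ 2.
Proof. by rewrite l2_normE sqrtCK; case: (l2dot_spec f). Qed.

Lemma norm_le_psum f e : 0 <= e -> (forall A, psum (fun x => `|f x| ^+ 2) A <= e ^+ 2) ->
  `|f| <= e.
Proof.
move=> e0 H; rewrite -(@ler_pXn2r _ 2) ?nnegrE// l2_normE sqrtCK.
by have [_] := l2dot_spec f; apply.
Qed.

Lemma l2_coord_le f x : `|f x| <= `|f|.
Proof.
rewrite -(@ler_pXn2r _ 2) ?nnegrE//; apply: le_trans (psum_le_norm f [fset x]%fset).
by rewrite psumE big_seq_fset1.
Qed.

Lemma cvg_seq_sum (I : Type) (F : set_system I) (FF : Filter F) (J : Type) (s : seq J)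
  (h : J -> I -> R) (l : J -> R) :
  (forall j, h j @ F --> l j) ->
  (fun i => \sum_(j <- s) h j i) @ F --> \sum_(j <- s) l j.
Proof.
move=> H; elim: s => [|j s IH].
  rewrite big_nil; under eq_fun do rewrite big_nil; exact: cvg_cst.
rewrite big_cons; under eq_fun do rewrite big_cons; exact: cvgD.
Qed.

Fact l2_complete (F : set_system l2) : ProperFilter F -> cauchy F -> cvg F.
Proof.
move=> FF /cauchyP Fc.
have NI (z : C) : `|complex.Im z|%:C%C <= `|z|.
  have := normc_ge_Re (z * 'i%C); rewrite complex.ReiNIm normrN normrM.
  by rewrite [X in _ * X](_ : _ = 1) ?mulr1// normc_def /= expr0n expr1n add0r sqrtr1.
have part (p : C -> R) : (forall a b, p (a - b) = p a - p b) ->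
    (forall z, `|p z|%:C%C <= `|z|) -> exists l : T -> R,
    forall x, (fun f => p (l2val f x)) @ F --> l x.
  move=> pB pn; suff /choice[h hP] : forall x, exists y : R, (fun f : l2 => p (l2val f x)) @ F --> y by exists h.
  move=> x.
  apply/cvg_ex.
  apply: R_complete; apply: cauchy_exP => e e0.
  have [|f Ff] := Fc e%:C%C; first by rewrite ltcR.
  exists (p (f x)); rewrite /fmap /=; apply: filterS Ff => g.
  rewrite -!ball_normE /= => fg; rewrite -ltcR.
  apply: le_lt_trans fg; rewrite -pB; apply: le_trans (pn _) _.
  exact: (l2_coord_le (f - g)).
have [re reP] := part (@complex.Re R) (fun a b => ltac:(by case: a; case: b)) (@normc_ge_Re R).
have [im imP] := part (@complex.Im R) (fun a b => ltac:(by case: a; case: b)) NI.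
pose l x : C := (re x +i* im x)%C.
have key (e : C) f : 0 < e -> F (ball f e) -> forall A, psum (fun x => `|f x - l x| ^+ 2) A <= e ^+ 2.
  move=> e0 Ff A.
  have eR : e = (complex.Re e)%:C%C.
    by have /ger0_Im := ltW e0; case: (e) => a b /= ->.
  pose q (z : C) := complex.Re z ^+ 2 + complex.Im z ^+ 2.
  have qE h : psum (fun x => `|h x| ^+ 2) A = (\sum_(x <- A) q (h x))%:C%C.
    by rewrite psumE rmorph_sum; apply: eq_bigr => x _; rewrite /q -add_Re2_Im2.
  rewrite qE eR -rmorphXn lecR.
  apply: (@cvgr_to_le _ F _ _ (fun g : l2 => \sum_(x <- A) q (f x - g x))).
    apply: cvg_seq_sum => x; rewrite /q /l.
    have ReB (a b : C) : complex.Re (a - b) = complex.Re a - complex.Re b by case: a; case: b.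
    have ImB (a b : C) : complex.Im (a - b) = complex.Im a - complex.Im b by case: a; case: b.
    rewrite ReB ImB /=; under eq_fun do rewrite ReB ImB.
    by apply: cvgD; rewrite !expr2; under eq_fun do rewrite expr2;
      apply: cvgM; apply: cvgB => //; exact: cvg_cst.
  apply: filterS Ff => g; rewrite -ball_normE /= => fg.
  rewrite -lecR rmorphXn/= -eR -(qE (fun x => f x - g x)).
  apply: le_trans (psum_le_norm (f - g) A) _.
  by apply: lerXn2r; rewrite ?nnegrE// ltW.
have [f1 Ff1] := Fc 1 ltr01.
have lS : l \in @sqsummable R T.
  have H : sqsum (fun x => f1 x - l x) by exists (1 ^+ 2); exact: key.
  have -> : l = l2val f1 - (fun x => f1 x - l x) :> (T -> C).
    by apply/funext => x; rewrite [RHS](_ : _ = f1 x - (f1 x - l x))// opprB addrC subrK.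
  by rewrite rpredB ?l2P//; apply/sqsummableP.
apply/cvg_ex; exists (L2 lS); apply/cvgrPdist_le => e e0.
have e2 : 0 < e / 2 by rewrite divr_gt0.
have [f Ff] := Fc _ e2.
have fl : `|f - L2 lS| <= e / 2 by apply: norm_le_psum (ltW e2) _; apply: key.
apply: filterS Ff => g; rewrite -ball_normE /= => fg.
rewrite -[X in X - g](subrK f) -addrA [leRHS]splitr.
apply: le_trans (ler_normD _ _) _; apply: lerD; first by rewrite distrC.
exact: ltW.
Qed.

HB.instance Definition _ := Uniform_isComplete.Build l2 l2_complete.

End L2norm.

(* [{dot _ for Num.conj}] is a positive definite sesquilinear form that is
   linear in its first argument. *)
Record hilbert (R : realType) := Hilbert {
  hspace :> completeNormedModType R[i];
  hdot : {dot hspace for Num.conj};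
  hnormE : forall x : hspace, `|x| = sqrtC (hdot x x)
}.
Arguments hdot {R h}.

Definition ell2 (R : realType) (T : choiceType) : hilbert R :=
  @Hilbert R (l2 R T) (@l2dot R T) (@l2_normE R T).

Section UnitaryRepresentations.
Variables (R : realType) (G : groupType).
Local Notation C := R[i].

Record unirep (H : hilbert R) := UniRep {
  rep :> G -> H -> H;
  rep_linear : forall s, linear (rep s);
  rep1 : forall x, rep 1%g x = x;
  repM : forall s t x, rep (s * t)%g x = rep s (rep t x);
  rep_unitary : forall s x y, hdot (rep s x) (rep s y) = hdot x y
}.

Let shift (s : G) (A : {fset G}) : {fset G} := [fset (s^-1 * x)%g | x in A]%fset.

Let psum_shift (h : G -> C) s A :
  psum (fun x => h (s^-1 * x)%g) A = psum h (shift s A).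
Proof.
rewrite !psumE big_imfset//= => x y _ _; exact: mulgI.
Qed.

Fact translate_subproof (f : ell2 R G) s :
  (fun x => f (s^-1 * x)%g) \in @sqsummable R G.
Proof.
apply/sqsummableP; have [M HM] := l2_sqsum f; exists M => A.
by rewrite (psum_shift (fun x => `|f x| ^+ 2)); apply: HM.
Qed.

Definition translate s (f : ell2 R G) : ell2 R G := L2 (translate_subproof f s).

Fact translate_linear s : linear (translate s).
Proof. by move=> a f g; apply/val_inj/funext. Qed.

Fact translate1 f : translate 1%g f = f.
Proof. by apply/val_inj/funext => x /=; rewrite invg1 mul1g. Qed.

Fact translateM s t f : translate (s * t)%g f = translate s (translate t f).
Proof. by apply/val_inj/funext => x /=; rewrite invgM mulgA. Qed.

Fact translate_unitary s f g :
  hdot (translate s f) (translate s g) = hdot f g.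
Proof.
apply: l2dot_unique => /=.
rewrite [X in X @ _ --> _](_ : _ =
    psum (fun x => f x * (g x)^* : C^o) \o shift s).
  apply: cvg_comp; last exact: l2dot_cvg.
  move=> P [A _ AP]; exists (shift s^-1%g A) => // B /= AB; apply: AP => /=.
  apply/fsubsetP => x xA; apply/imfsetP; exists (s * x)%g; last by rewrite mulKg.
  by apply/(fsubsetP AB)/imfsetP; exists x => //=; rewrite invgK.
by apply/funext => A; rewrite (psum_shift (fun x => f x * (g x)^* : C^o)).
Qed.

Definition regular_rep : unirep (ell2 R G) :=
  UniRep translate_linear translate1 translateM translate_unitary.
End UnitaryRepresentations.

Section GroupAlgebra.
Variables (R : realType) (G : groupType).
Local Notation C := R[i].

(* The group algebra CG is the set of finitely supported functions on G, so
   that every [\sum_(s \in [set: G])] below is a finite sum. *)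
Definition group_algebra : set (G -> C) :=
  [set a | finite_set [set s | a s != 0]].

Definition ga_mul (a b : G -> C) : G -> C :=
  fun s => \sum_(t \in [set: G]) a t * b (t^-1 * s)%g.

Definition ga_star (a : G -> C) : G -> C := fun s => (a s^-1%g)^*.

Definition ga_translate (s : G) (a : G -> C) : G -> C :=
  fun t => a (s^-1 * t)%g.

Definition ga_poly (p : {poly C}) (u : G) : G -> C :=
  fun s => \sum_(k < size p) p`_k *+ (s == (u ^+ k)%g).

Definition ga_eval (phi : G -> C) (a : G -> C) : C :=
  \sum_(s \in [set: G]) a s * phi s.

Definition rep_alg (H : hilbert R) (pi : unirep G H) (a : G -> C) (x : H) : H :=
  \sum_(s \in [set: G]) a s *: pi s x.

Definition positive_definite (phi : G -> C) :=
  forall (m : nat) (s : 'I_m -> G) (c : 'I_m -> C),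
    0 <= \sum_(i < m) \sum_(j < m) c i * (c j)^* * phi ((s j)^-1 * s i)%g.

Definition is_state (phi : G -> C) := positive_definite phi /\ phi 1%g = 1.

(* Membership in the operator-norm closure of the image of CG is
   approximation by [rep_alg (regular_rep R G) a] in operator norm. *)
Definition reduced_Cstar : set (ell2 R G -> ell2 R G) :=
  [set T | linear T /\ forall e : C, 0 < e -> exists2 a, group_algebra a &
     forall f, `|T f - rep_alg (regular_rep R G) a f| <= e * `|f| ].

Definition is_adjoint (H : hilbert R) (T S : H -> H) :=
  forall x y, hdot (T x) y = hdot x (S y).

Definition is_reduced (phi : G -> C) :=
  exists Phi : (ell2 R G -> ell2 R G) -> C,
  [/\ forall c S T, reduced_Cstar S -> reduced_Cstar T ->
        Phi (fun f => c *: S f + T f) = c * Phi S + Phi T,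
      forall T S, reduced_Cstar T -> is_adjoint T S -> 0 <= Phi (S \o T) &
      forall a, group_algebra a ->
        Phi (rep_alg (regular_rep R G) a) = ga_eval phi a].

(* Fell's definition; compact subsets of the discrete group G are finite. *)
Definition weakly_contained (H K : hilbert R) (pi : unirep G H)
    (sigma : unirep G K) :=
  forall (x : H) (Q : set G) (e : C), finite_set Q -> 0 < e ->
  exists (m : nat) (y : 'I_m -> K), forall s, Q s ->
    `|hdot (pi s x) x - \sum_(i < m) hdot (sigma s (y i)) (y i)| < e.

End GroupAlgebra.

Section Subrepresentations.
Variables (R : realType) (G : groupType) (H : hilbert R) (pi : unirep G H).
Local Notation C := R[i].

Definition closed_subspace (V : set H) :=
  [/\ closed V, V 0 & forall (c : C) x y, V x -> V y -> V (c *: x + y)].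

Definition closed_span (A : set H) : set H := smallest closed_subspace A.

Definition subrep (V : set H) :=
  closed_subspace V /\ forall s x, V x -> V (pi s x).

Definition subrep_span (A : set H) : set H :=
  closed_span [set pi s x | s in [set: G] & x in A].

(* The restriction of [pi] to [V] is the GNS representation of [phi]: [V] is
   the completion of CG for the (degenerate) inner product
   <a, b> = phi (b^* a), [L] being the canonical map with dense range, and
   [pi] extends left multiplication on CG. *)
Definition is_GNS (V : set H) (phi : G -> C) :=
  exists L : (G -> C) -> H,
  [/\ forall c a b, @group_algebra R G a -> group_algebra b ->
        L (c *: a + b) = c *: L a + L b,
      forall a b, group_algebra a -> group_algebra b ->
        hdot (L a) (L b) = ga_eval phi (ga_mul (ga_star b) a),
      V = closure (L @` @group_algebra R G) &
      forall s a, group_algebra a -> pi s (L a) = L (ga_translate s a)].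

Definition is_direct_sum (V : set H) (I : Type) (W : I -> set H) :=
  [/\ forall i, subrep (W i),
      forall i j x y, i <> j -> W i x -> W j y -> hdot x y = 0 &
      V = closed_span (\bigcup_i W i)].

End Subrepresentations.

Section FreeGroup.
Variable G : groupType.

(* The letter (i, false) stands for u_i and (i, true) for its inverse. *)
Definition word_eval (n : nat) (u : 'I_n -> G) (w : seq ('I_n * bool)) : G :=
  (\prod_(l <- w) (if l.2 then (u l.1)^-1 else u l.1))%g.

Definition reduced_word (n : nat) (w : seq ('I_n * bool)) :=
  sorted (fun l m => ~~ ((l.1 == m.1) && (l.2 != m.2))) w.

Definition free_group_on (n : nat) (u : 'I_n -> G) :=
  forall g : G, exists! w, reduced_word w /\ word_eval u w = g.

Definition gexpz (x : G) (j : int) : G :=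
  match j with Posz k => (x ^+ k)%g | Negz k => (x ^- k.+1)%g end.

(* If [u] has infinite order, the sum has the single term z ^ j when
   s = u ^ j, and no term when [s] is not a power of [u]. *)
Definition chi (R : realType) (u : G) (z : R[i]) (s : G) : R[i] :=
  \sum_(j \in [set j : int | s = gexpz u j]) z ^ j.

End FreeGroup.

(* Main.v *)
(** Write [u_1] for the distinguished generator and [G_1] for the subgroup it
    generates. If [s] is not in [G_1], the elements [x_k = u_1^k s u_1^k] behave
    like free generators: [x_k] maps the words whose leading power of [u_1] has
    an exponent other than [j - k] to words with leading exponent [k + i].
    Hence [sum_(k < N) c_k lambda(x_k)], with [|c_k| = 1], has norm at most
    [2 sqrt N]. If [u_1 v = z v] and [u_1 w = z' w] in a representation weakly
    contained in the regular one, then [c_k = conj (z z')^k] makes all the terms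
    [<c_k x_k v, w>] equal to [<s v, w>], so that [N |<s v, w>| = O(sqrt N)] and
    [<s v, w> = 0]. A vector annihilated by [p(u_1)] is a sum of eigenvectors of
    the isometry [u_1], whose eigenvalues are zeros of [p] on the unit circle.

    For a reduced state the bound is transferred from [lambda] by the square
    root of [1 - X], for [X] self-adjoint with [|X| <= 1/2], which lies in the
    reduced C*-algebra. For a representation, a maximal orthonormal set of
    eigenvectors generates the required direct sum. *)
Require Import Defs.
From HB Require Import structures.
From mathcomp Require Import all_boot all_order all_algebra.
From mathcomp Require Import complex finmap.
From mathcomp Require Import all_classical all_reals all_analysis.
From mathcomp Require Import ring.
From mathcomp Require summability.
Set Implicit Arguments.
Unset Strict Implicit.
Unset Printing Implicit Defensive.
Import Order.TTheory GRing.Theory Num.Theory numFieldNormedType.Exports.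
Local Open Scope classical_set_scope.
Local Open Scope ring_scope.

(** * Free groups *)

(** Both halves rest on one argument about a positive semidefinite form preserved by an action of
    $G$. For a state the space is the group algebra with <a, b> = psi (b^* a). This form may be
    degenerate, and no GNS completion is built: an equality of vectors is replaced by the statement
    that a difference is null.

    The norm estimate enters only through [tempered_vector], with an unspecified constant K. The
    final comparison is between N^2 and a multiple of N, so constant factors are harmless. This
    allows the loss of a factor 2 for states. Positivity of the extension of a reduced state is
    known only on products of an operator with its adjoint, so [2 M - a^* a >= 0] becomes usable
    only once [1 - a^* a / (2 M)] is a square inside the reduced C*-algebra. Asking for norm at most
    1/2, rather than 1, makes the square root iteration converge geometrically. *)

Lemma gexpzS (G : groupType) (x : G) j : gexpz x (1 + j) = (x * gexpz x j)%g.
Proof.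
case: j => [k|[|k]].
  by rewrite -intS /= expgS.
  by rewrite /= expg1 mulgV.
have -> : 1 + Negz k.+1 = Negz k by rewrite !NegzE [in LHS]intS opprD addrA subrr add0r.
by rewrite /= [in RHS]expgSr invgM mulVKg.
Qed.

Lemma gexpzP (G : groupType) (x : G) j : gexpz x (j - 1) = (x^-1 * gexpz x j)%g.
Proof. by rewrite -{2}(subrK 1 j) (addrC _ 1) gexpzS mulKg. Qed.

Section FreeGroupExponent.
Variables (G : groupType) (n : nat) (u : 'I_n -> G).
Hypothesis freeG : free_group_on u.
Variable o : 'I_n.
Local Notation letter := ('I_n * bool)%type.
Implicit Types (w : seq letter) (g s : G) (l : letter).

Let word g : seq letter := projT1 (cid (freeG g)).

Let word_reduced g : reduced_word (word g).
Proof. by rewrite /word; case: cid => w [[]]. Qed.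

Let wordK g : word_eval u (word g) = g.
Proof. by rewrite /word; case: cid => w [[]]. Qed.

Let word_uniq g w : reduced_word w -> word_eval u w = g -> word g = w.
Proof.
by move=> rw wg; rewrite /word; case: cid => w' [_ /= H]; exact: H.
Qed.

Let word_eval_cons l w : word_eval u (l :: w) = (word_eval u [:: l] * word_eval u w)%g.
Proof. by rewrite /word_eval !big_cons big_nil mulg1. Qed.

Let word_eval_cat w w' : word_eval u (w ++ w') = (word_eval u w * word_eval u w')%g.
Proof. by rewrite /word_eval big_cat. Qed.

(** In a reduced word the leading letters with index [o] all have the same sign, so this is the
    exponent of the leading power of u_o; everything after the first other letter is ignored. *)
Fixpoint word_exponent w : int :=
  if w is l :: w' then
    if l.1 == o then (if l.2 then -1 else 1) + word_exponent w' else 0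
  else 0.

Let word_exponent_cat w l w' : l.1 != o ->
  word_exponent (w ++ l :: w') = word_exponent (w ++ [:: l]).
Proof.
move=> lo; elim: w => [|a w IH] /=; first by rewrite (negPf lo).
by rewrite IH.
Qed.

Definition exponent g : int := word_exponent (word g).

(** Nothing cancels at the junction, because the letters meeting there have different indices. The
    tail [w2] serves only to present [w1] followed by [l] as a prefix of a reduced word. *)
Let reduced_join w1 l w2 w : reduced_word (w1 ++ l :: w2) -> l.1 != o ->
  reduced_word w -> (if w is m :: _ then m.1 == o else true) ->
  reduced_word (w1 ++ l :: w).
Proof.
move=> r lo rw wo.
have pw : path (fun l m : letter => ~~ ((l.1 == m.1) && (l.2 != m.2))) l w.
  case: w wo rw => //= m w /eqP mo ->; rewrite mo (negPf lo) /=; exact: isT.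
by case: w1 r => //= a w1; rewrite /reduced_word /= !cat_path /= => /and3P[-> -> _].
Qed.

Let word_generator g : word (u o * g)%g =
  if word g is (i, true) :: w then if i == o then w else (o, false) :: word g
  else (o, false) :: word g.
Proof.
apply: word_uniq.
  have := word_reduced g; rewrite /reduced_word.
  case: (word g) => [|[i []] w] //=.
    case: eqVneq => [->|io] //=; last by rewrite eq_sym (negPf io).
    exact: path_sorted.
  by move=> ->; rewrite andbF.
have E : u o = word_eval u [:: (o, false)].
  by rewrite /word_eval big_cons big_nil mulg1.
have D : word_eval u ((o, false) :: word g) = (u o * g)%g.
  by rewrite word_eval_cons -E wordK.
have := wordK g; case wg : (word g) => [|[i []] w] ge //; rewrite -?wg //.
case: eqVneq => [io|//].
by rewrite -ge io word_eval_cons {2}/word_eval big_cons big_nil /= mulg1 mulVKg.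
Qed.

Lemma exponent_generator g : exponent (u o * g)%g = 1 + exponent g.
Proof.
rewrite /exponent word_generator; case: (word g) => [|[i []] w] /=.
- by rewrite eqxx.
- case: eqVneq => [_|io] /=; last by rewrite eqxx /= (negPf io).
  by rewrite addrA subrr add0r.
- by rewrite eqxx.
Qed.

Lemma exponent_gexpz j g : exponent (gexpz (u o) j * g)%g = j + exponent g.
Proof.
have P k h : exponent (u o ^+ k * h)%g = k%:Z + exponent h.
  elim: k h => [|k IH] h; first by rewrite expg0 mul1g add0r.
  by rewrite expgS -mulgA exponent_generator IH addrA -intS.
case: j => k; first exact: P.
by rewrite /= -{2}(mulVKg (u o ^+ k.+1)%g g) P addrA NegzE addNr add0r.
Qed.

Lemma exponent1 : exponent 1%g = 0.
Proof. by rewrite /exponent (@word_uniq _ [::]) // /word_eval big_nil. Qed.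

(** The exponent recovers j, so u_o has infinite order and the sum defining [chi] has at most one
    term. *)
Lemma gexpz_inj : injective (gexpz (u o)).
Proof.
move=> i j /(congr1 exponent).
by rewrite -[X in exponent X = _]mulg1 -[X in _ = exponent X]mulg1 !exponent_gexpz
  exponent1 !addr0.
Qed.

Let power_word w : all (fun l => l.1 == o) w ->
  exists j, word_eval u w = gexpz (u o) j.
Proof.
elim: w => [|[i b] w IH] /=; first by exists 0; rewrite /word_eval big_nil.
move=> /andP[/eqP -> /IH[j wj]]; rewrite word_eval_cons wj.
rewrite {1}/word_eval big_cons big_nil mulg1 /=; case: b.
  by exists (j - 1); rewrite gexpzP.
by exists (1 + j); rewrite gexpzS.
Qed.

Let split_last w : all (fun l => l.1 == o) w \/
  exists w1 l w2, [/\ w = w1 ++ l :: w2, l.1 != o & all (fun l => l.1 == o) w2].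
Proof.
elim: w => [|a w [IH|[w1 [l [w2 [-> lo w2o]]]]]]; first by left.
  case: (boolP (a.1 == o)) => ao; first by left; rewrite /= ao.
  by right; exists [::], a, w.
by right; exists (a :: w1), l, w2.
Qed.

(* Write [s = s1 u_o^a] with [s1] ending in a letter other than [u_o^{+-1}]:
   if [u_o^a g] still begins with [u_o^{+-1}], then nothing cancels in
   [s1 (u_o^a g)], whose exponent is that of [s1]. *)
Lemma exponent_outside s : (forall j, s <> gexpz (u o) j) ->
  exists i j, forall g, exponent g != j -> exponent (s * g)%g = i.
Proof.
move=> sG1; have [/power_word[j]|] := split_last (word s).
  by rewrite wordK => /sG1.
move=> [w1 [l [w2 [sw lo /power_word[a w2a]]]]].
exists (word_exponent (w1 ++ [:: l])), (- a) => g ga.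
set h := (gexpz (u o) a * g)%g.
have eh : exponent h != 0 by rewrite exponent_gexpz addrC addr_eq0.
rewrite /exponent (_ : word _ = w1 ++ l :: word h); first exact: word_exponent_cat.
apply: word_uniq.
  apply: (@reduced_join _ _ w2); rewrite -?sw //.
  move: eh; rewrite /exponent; case: (word h) => //= m w.
  by case: ifP => // _; rewrite eqxx.
rewrite -(wordK s) sw !word_eval_cat word_eval_cons wordK.
by rewrite (word_eval_cons l w2) w2a !mulgA.
Qed.

Lemma chi_gexpz (R : realType) (z : R[i]) j : chi (u o) z (gexpz (u o) j) = z ^ j.
Proof.
rewrite /chi (_ : [set _ | _] = [set j]) ?fsbig_set1 //.
by apply/seteqP; split=> [i /gexpz_inj|i ->].
Qed.

Lemma chi_outside (R : realType) (z : R[i]) s : (forall j, s <> gexpz (u o) j) ->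
  chi (u o) z s = 0.
Proof.
move=> sG1; rewrite /chi (_ : [set _ | _] = set0) ?fsbig_set0 //.
by apply/seteqP; split=> // j /sG1.
Qed.

End FreeGroupExponent.

(** * Semidefinite forms and isometries *)

Section SemidefiniteForm.
Variables (C : numClosedFieldType) (V : lmodType C).
Variable form : {hermitian V for false & Num.conj}.
Hypothesis form_ge0 : forall v, 0 <= form v v.
Implicit Types (x y v w : V) (a : C).

Lemma herm_conj v w : form v w = (form w v)^*.
Proof. by rewrite hermC expr0 mul1r. Qed.

Lemma hermZl a v w : form (a *: v) w = a * form v w.
Proof. by rewrite linearZl_LR. Qed.

Lemma hermZr a v w : form v (a *: w) = a^* * form v w.
Proof. by rewrite linearZr_LR. Qed.

Lemma herm_suml (I : Type) (r : seq I) (P : pred I) (F : I -> V) w :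
  form (\sum_(i <- r | P i) F i) w = \sum_(i <- r | P i) form (F i) w.
Proof. exact: linear_sumlz. Qed.

Lemma herm_sumr (I : Type) (r : seq I) (P : pred I) (F : I -> V) w :
  form w (\sum_(i <- r | P i) F i) = \sum_(i <- r | P i) form w (F i).
Proof. exact: linear_sumr. Qed.

Lemma herm_self_conj v : (form v v)^* = form v v.
Proof. by rewrite -herm_conj. Qed.

Lemma semi_hnormZ a v : form (a *: v) (a *: v) = `|a| ^+ 2 * form v v.
Proof. by rewrite hermZl hermZr mulrA normCK. Qed.

Definition form_null v := form v v = 0.

(** This must precede Cauchy-Schwarz, whose proof divides by [form w w]. If [form v w] were nonzero,
    a large enough multiple of the null vector [v] subtracted from [w] would have a negative
    square. *)
Lemma form_null_l v w : form_null v -> form v w = 0.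
Proof.
move=> v0; apply/eqP/negPn/negP => vw.
have vw0 : `|form v w| ^+ 2 != 0 by rewrite expf_eq0 normr_eq0.
(* With this t the square of [w - t (form v w)^* v] equals [- (form w w + 2)]. *)
pose t : C := (form w w + 1) / `|form v w| ^+ 2.
have tr : t^* = t.
  by rewrite /t rmorphM/= fmorphV/= rmorphXn/= conj_normC rmorphD/= rmorph1 herm_self_conj.
have := form_ge0 (w - (t * (form v w)^*) *: v).
rewrite hnormB expr0 mul1r semi_hnormZ v0 mulr0 addr0 hermZr rmorphM/= tr conjCK.
rewrite -mulrA (herm_conj w v) -normCK rmorphM/= tr rmorphXn/= conj_normC.
rewrite /t divfK// -[form w w in X in X - _]addr0 => H.
have : 0 <= - (form w w + 2).
  by apply: le_trans H _; rewrite le_eqVlt; apply/orP; left; apply/eqP; ring.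
by rewrite oppr_ge0 lt_geF // ltr_wpDl.
Qed.

Lemma form_null_r v w : form_null w -> form v w = 0.
Proof. by move=> w0; rewrite herm_conj form_null_l// rmorph0. Qed.

Lemma form_nullP a v w : form_null v -> form_null w -> form_null (a *: v + w).
Proof.
by move=> v0 w0; rewrite /form_null linearDl/= hermZl !form_null_l// mulr0 addr0.
Qed.

Lemma form_null0 : form_null 0.
Proof. by rewrite /form_null linear0l. Qed.

Lemma form_nullZ a v : form_null v -> form_null (a *: v).
Proof. by move=> v0; rewrite -[_ *: _]addr0; apply: form_nullP form_null0. Qed.

Lemma form_nullD v w : form_null v -> form_null w -> form_null (v + w).
Proof. by move=> v0 w0; rewrite -[v]scale1r; apply: form_nullP. Qed.

Lemma form_nullN v : form_null v -> form_null (- v).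
Proof. by rewrite -scaleN1r; exact: form_nullZ. Qed.

Lemma form_eq_l v v' w : form_null (v - v') -> form v w = form v' w.
Proof. by move/form_null_l => /(_ w); rewrite linearBl/= => /subr0_eq. Qed.

Lemma form_eq_r v v' w : form_null (v - v') -> form w v = form w v'.
Proof. by move=> H; rewrite herm_conj (form_eq_l _ H) -herm_conj. Qed.

Lemma semi_CS v w : `|form v w| ^+ 2 <= form v v * form w w.
Proof.
have [w0|w0] := eqVneq (form w w) 0.
  by rewrite form_null_r// normr0 expr0n /= mulr_ge0.
have wp : 0 < form w w by rewrite lt_def w0 form_ge0.
have := form_ge0 (v - (form v w / form w w) *: w).
rewrite hnormB expr0 mul1r semi_hnormZ hermZr rmorphM/= fmorphV/= herm_self_conj.
rewrite rmorphM/= rmorphM/= conjCK fmorphV/= herm_self_conj !normCK rmorphM/= fmorphV/=.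
rewrite herm_self_conj -(ler_pM2r wp) mul0r => H.
rewrite -subr_ge0; apply: le_trans H _.
by rewrite le_eqVlt; apply/orP; left; apply/eqP; field.
Qed.

Lemma hnorm_sum_le (I : finType) (v : I -> V) :
  form (\sum_i v i) (\sum_i v i) <= #|I|%:R * \sum_i form (v i) (v i).
Proof.
(* The double sum expands to twice the difference of the two sides. *)
have : 0 <= \sum_i \sum_j form (v i - v j) (v i - v j).
  by apply: sumr_ge0 => i _; apply: sumr_ge0 => j _.
set S := \sum_i v i; set Q := \sum_i form (v i) (v i).
rewrite (_ : \sum_i _ = 2 * (#|I|%:R * Q - form S S)).
  by rewrite pmulr_rge0// subr_ge0.
under eq_bigr => i _.
  under eq_bigr => j _ do rewrite linearBl/= !linearBr/=.
  rewrite !sumrB sumr_const -linear_sumr -linear_sumlz /= -/S -/Q; over.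
rewrite !sumrB sumr_const -linear_sumr -linear_sumlz sumrMnl -/Q -/S /=.
by rewrite -[Q *+ _]mulr_natl; ring.
Qed.

Lemma hnorm_sum_orthogonal (I : finType) (v : I -> V) :
  (forall i j, i != j -> form (v i) (v j) = 0) ->
  form (\sum_i v i) (\sum_i v i) = \sum_i form (v i) (v i).
Proof.
move=> vo; rewrite linear_sumlz; apply: eq_bigr => i _.
rewrite linear_sumr (bigD1 i)//= big1 ?addr0// => j ji.
by apply: vo; rewrite eq_sym.
Qed.

Lemma hnormD_le v w : form (v + w) (v + w) <= 2 * (form v v + form w w).
Proof.
rewrite -subr_ge0; apply: le_trans (form_ge0 (v - w)) _.
by rewrite le_eqVlt; apply/orP; left; apply/eqP; rewrite hnormB hnormD expr0 mul1r; ring.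
Qed.

End SemidefiniteForm.

(** * Eigenvectors of an isometry for a semidefinite form *)

Section IsometryEigenvectors.
Variables (C : numClosedFieldType) (V : lmodType C).
Variable form : {hermitian V for false & Num.conj}.
Hypothesis form_ge0 : forall v, 0 <= form v v.
Variable U : V -> V.
Hypotheses (U_linear : linear U) (U_isom : forall v w, form (U v) (U w) = form v w).
Implicit Types (x y v w : V) (a z r : C) (p q : {poly C}).
Local Notation null := (form_null form).

Let U0 : U 0 = 0.
Proof. by have := U_linear (-1) 0 0; rewrite !scaler0 addr0 scaleN1r addNr. Qed.

Let UD v w : U (v + w) = U v + U w.
Proof. by rewrite -[v]scale1r U_linear !scale1r. Qed.

Let UZ a v : U (a *: v) = a *: U v.
Proof. by rewrite -[a *: v]addr0 U_linear U0 addr0. Qed.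

Let UN v : U (- v) = - U v.
Proof. by rewrite -scaleN1r UZ scaleN1r. Qed.

Let U_sum (I : Type) (s : seq I) (P : pred I) (F : I -> V) :
  U (\sum_(i <- s | P i) F i) = \sum_(i <- s | P i) U (F i).
Proof. exact: (big_morph U UD U0). Qed.

Definition poly_act p v := \sum_(k < size p) p`_k *: iter k U v.

Lemma poly_act_widen n p v : (size p <= n)%N ->
  poly_act p v = \sum_(k < n) p`_k *: iter k U v.
Proof.
move=> pn; rewrite /poly_act (big_ord_widen _ (fun k => p`_k *: iter k U v) pn).
rewrite big_mkcond; apply: eq_bigr => k _; case: ltnP => // pk.
by rewrite nth_default// scale0r.
Qed.

Let iter_linear k a v w : iter k U (a *: v + w) = a *: iter k U v + iter k U w.
Proof. by elim: k => //= k ->; rewrite U_linear. Qed.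

Lemma poly_act_factor p r v :
  poly_act (p * ('X - r%:P)) v = poly_act p (U v - r *: v).
Proof.
rewrite (@poly_act_widen (size p).+1); last first.
  by apply: leq_trans (size_polyMleq _ _) _; rewrite size_XsubC addn2.
under eq_bigr do rewrite mulrBr coefB coefMX coefMC scalerBl.
rewrite sumrB big_ord_recl /= scale0r add0r [X in _ - X]big_ord_recr /=.
rewrite [p`_(size p)]nth_default// mul0r scale0r addr0 -sumrB.
apply: eq_bigr => k _; rewrite (_ : U v - r *: v = - r *: v + U v); last by rewrite scaleNr addrC.
by rewrite iter_linear -iterSr /= scalerDr scalerA mulrN scaleNr addrC.
Qed.

(** The eigenvalue equation holds modulo null vectors only, and [v] may itself be null. *)
Definition eigenvector z v := null (U v - z *: v).

Lemma form_null_isom v : null v -> null (U v).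
Proof. by rewrite /form_null U_isom. Qed.

Lemma eigenvector_form z z' v w : eigenvector z v -> eigenvector z' w ->
  form v w = z * z'^* * form v w.
Proof.
move=> vz wz; rewrite -[LHS]U_isom (form_eq_l form_ge0 _ vz) (form_eq_r form_ge0 _ wz).
by rewrite hermZl hermZr mulrA.
Qed.

Lemma eigenvector_null z v : eigenvector z v -> `|z| != 1 -> null v.
Proof.
move=> vz z1; have /eqP := eigenvector_form vz vz.
rewrite -normCK -subr_eq0 -[X in X - _]mul1r -mulrBl mulf_eq0 => /orP[|/eqP//].
by rewrite subr_eq0 eq_sym pexpr_eq1// (negPf z1).
Qed.

(** On the unit circle the inverse of z' is its conjugate, so z z'^* = 1 would force z = z'. *)
Lemma eigenvector_orthogonal z z' v w : `|z'| = 1 -> z != z' ->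
  eigenvector z v -> eigenvector z' w -> form v w = 0.
Proof.
move=> z1 zz' vz wz; have /eqP := eigenvector_form vz wz.
rewrite -subr_eq0 -[X in X - _]mul1r -mulrBl mulf_eq0 => /orP[|/eqP//].
rewrite subr_eq0 => /eqP H; case/eqP: zz'; rewrite -[LHS]mulr1.
have -> : 1 = z'^* * z' by rewrite mulrC -normCK z1 expr1n.
by rewrite mulrA -H mul1r.
Qed.

(* The range of [U - z] is orthogonal to its kernel, [U] being isometric. *)
Lemma eigenvector_range_null z v x : `|z| = 1 -> eigenvector z v ->
  null (U x - z *: x - v) -> null v.
Proof.
move=> z1 vz xv; rewrite /form_null -[LHS](form_eq_l form_ge0 _ xv) linearBl /= hermZl.
have zz : z * z^* = 1 by rewrite -normCK z1 expr1n.
rewrite -[X in _ - _ * X]U_isom (form_eq_r form_ge0 _ vz) hermZr mulrA zz mul1r.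
by rewrite subrr.
Qed.

(** Induction on the roots: (U - r) v is decomposed by the remaining ones. Dividing the component at
    z by z - r inverts U - r on it, and what remains of [v] is the component at r. Repeated roots in
    [rs] create no generalized eigenvectors, since the kernel and the range of U - r meet in null
    vectors only. The set [S] stays fixed so that the induction can use the same index set at every
    stage. *)
Lemma eigenvector_decomposition (S rs : seq C) a v : uniq S -> {subset rs <= S} ->
  a != 0 -> null (poly_act (a *: \prod_(r <- rs) ('X - r%:P)) v) ->
  exists f : C -> V, null (v - \sum_(z <- S) f z) /\
    forall z, z \in S -> eigenvector z (f z).
Proof.
move=> uS + a0; elim: rs v => [|r rs IH] v rsS.
  rewrite big_nil => H; exists (fun=> 0); split=> [|z _]; last first.
    by rewrite /eigenvector U0 scaler0 subr0; exact: form_null0.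
  rewrite big1// subr0; move: H; rewrite (@poly_act_widen 1) ?alg_polyC ?size_polyC_leq1//.
  rewrite big_ord1 coefC /= => /(form_nullZ form_ge0 a^-1).
  by rewrite scalerA mulVf// scale1r.
rewrite big_cons mulrC scalerAl poly_act_factor => /IH[|f [yf fS]].
  by move=> z zrs; apply: rsS; rewrite inE zrs orbT.
set y := U v - r *: v in yf.
have rS : r \in S by apply: rsS; rewrite mem_head.
pose x := v - \sum_(z <- S | z != r) (z - r)^-1 *: f z.
(* That is, (U - r) x = f r modulo null vectors. The term f r is null: it is in the kernel and, up
   to a null vector, in the range of U - r if |r| = 1, and U has only null eigenvectors if |r|
   differs from 1. *)
have xE : null (U x - r *: x - f r).
  have -> : U x - r *: x - f r = (y - \sum_(z <- S) f z) -
     \sum_(z <- S | z != r) (z - r)^-1 *: (U (f z) - z *: f z).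
    rewrite (bigD1_seq r)//= /x UD UN U_sum.
    set D := (X in _ = _ - X); set T3 := \sum_(z <- S | _) f z.
    set T2 := \sum_(z <- S | _) (z - r)^-1 *: f z.
    have -> : \sum_(z <- S | z != r) U ((z - r)^-1 *: f z) = r *: T2 + (T3 + D).
      rewrite scaler_sumr -!big_split; apply: eq_bigr => z zr /=; rewrite UZ.
      have zr0 : z - r != 0 by rewrite subr_eq0.
      rewrite scalerBr !scalerA addrA addrCA -[LHS]addr0; congr (_ + _).
      rewrite -{2}[f z]scale1r -scalerDl -scalerBl.
      by rewrite (_ : _ - _ = 0) ?scale0r//; field.
    rewrite /y scalerBr !opprD !addrA opprK.
    by rewrite [LHS](AC (6*1) (1*5*7*3*4*2*6))/= subrK.
  apply: form_nullD => //; apply: form_nullN => //.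
  rewrite big_seq_cond; elim/big_rec: _ => [|z w /andP[zS _] w0].
    exact: form_null0.
  by apply: form_nullP => //; exact: fS.
have xr : eigenvector r x.
  have [r1|r1] := eqVneq `|r| 1.
    have fr0 := eigenvector_range_null r1 (fS _ rS) xE.
    by have := form_nullD form_ge0 xE fr0; rewrite subrK.
  have fr0 := eigenvector_null (fS _ rS) r1.
  by have := form_nullD form_ge0 xE fr0; rewrite subrK.
exists (fun z => if z == r then x else (z - r)^-1 *: f z); split.
  rewrite (bigD1_seq r)//= eqxx.
  rewrite (eq_bigr (fun z => (z - r)^-1 *: f z)); last first.
    by move=> z /negPf ->.
  by rewrite /x subrK subrr; exact: form_null0.
move=> z zS; case: eqP => [->//|_].
rewrite /eigenvector UZ scalerA mulrC -scalerA -scalerBr.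
by apply: form_nullZ => //; exact: fS.
Qed.
End IsometryEigenvectors.

(** * The regular representation *)

Section HilbertForm.
Variables (R : realType) (H : hilbert R).
Implicit Types (x y z : H) (a : R[i]).

Lemma hdot_ge0 x : 0 <= hdot x x.
Proof. exact: (dnorm_ge0 (@hdot R H)). Qed.

Lemma hdot_conj x y : hdot x y = (hdot y x)^*.
Proof. exact: herm_conj. Qed.

Lemma hdot_self_conj x : (hdot x x)^* = hdot x x.
Proof. exact: herm_self_conj. Qed.

Lemma hdotBl x y z : hdot (x - y) z = hdot x z - hdot y z.
Proof. exact: linearBl. Qed.

Lemma hdotBr x y z : hdot z (x - y) = hdot z x - hdot z y.
Proof. exact: linearBr. Qed.

Lemma hdotDl x y z : hdot (x + y) z = hdot x z + hdot y z.
Proof. exact: linearDl. Qed.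

Lemma hdotDr x y z : hdot z (x + y) = hdot z x + hdot z y.
Proof. exact: linearDr. Qed.

Lemma hdotZl a x y : hdot (a *: x) y = a * hdot x y.
Proof. exact: hermZl. Qed.

Lemma hdotZr a x y : hdot x (a *: y) = a^* * hdot x y.
Proof. exact: hermZr. Qed.

Lemma hdotZZ a x : hdot (a *: x) (a *: x) = `|a| ^+ 2 * hdot x x.
Proof. exact: semi_hnormZ. Qed.

Lemma hdot_suml (I : Type) (r : seq I) (P : pred I) (F : I -> H) y :
  hdot (\sum_(i <- r | P i) F i) y = \sum_(i <- r | P i) hdot (F i) y.
Proof. exact: linear_sumlz. Qed.

Lemma hdot_sumr (I : Type) (r : seq I) (P : pred I) (F : I -> H) y :
  hdot y (\sum_(i <- r | P i) F i) = \sum_(i <- r | P i) hdot y (F i).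
Proof. exact: linear_sumr. Qed.

Lemma hdot_CS x y : `|hdot x y| ^+ 2 <= hdot x x * hdot y y.
Proof. exact: (semi_CS hdot_ge0). Qed.

Lemma hdot_sum_le (I : finType) (v : I -> H) :
  hdot (\sum_i v i) (\sum_i v i) <= #|I|%:R * \sum_i hdot (v i) (v i).
Proof. exact: (hnorm_sum_le hdot_ge0). Qed.

Lemma hdot_sum_orthogonal (I : finType) (v : I -> H) :
  (forall i j, i != j -> hdot (v i) (v j) = 0) ->
  hdot (\sum_i v i) (\sum_i v i) = \sum_i hdot (v i) (v i).
Proof. exact: (@hnorm_sum_orthogonal _ _ (@hdot R H)). Qed.

Lemma hdotD_le x y : hdot (x + y) (x + y) <= 2 * (hdot x x + hdot y y).
Proof. exact: (hnormD_le hdot_ge0). Qed.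

End HilbertForm.

Section UnitaryRepresentationLinearity.
Variables (R : realType) (G : groupType) (H : hilbert R) (pi : unirep G H).

Lemma rep0 s : pi s 0 = 0.
Proof.
by have := rep_linear pi s (-1) 0 0; rewrite !scaler0 addr0 scaleN1r addNr.
Qed.

Lemma repD s x y : pi s (x + y) = pi s x + pi s y.
Proof. by rewrite -[x in LHS]scale1r rep_linear scale1r. Qed.

Lemma repZ s a x : pi s (a *: x) = a *: pi s x.
Proof. by rewrite -[a *: x]addr0 rep_linear rep0 addr0. Qed.

Lemma rep_sum s (I : Type) (r : seq I) (P : pred I) (F : I -> H) :
  pi s (\sum_(i <- r | P i) F i) = \sum_(i <- r | P i) pi s (F i).
Proof. exact: (big_morph _ (repD s) (rep0 s)). Qed.

Lemma rep_adjoint s x y : hdot (pi s x) y = hdot x (pi s^-1%g y).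
Proof. by rewrite -(rep_unitary pi s^-1%g) -repM mulVg rep1. Qed.

End UnitaryRepresentationLinearity.

(** * Norm estimate for sums of translations *)

Section RegularRepresentationBound.
Variables (R : realType) (G : groupType).
Local Notation C := R[i].
Local Notation ell2 := (ell2 R G).
Implicit Types (f g : ell2) (P Q : pred G).

Lemma l2dot_disjoint f g : (forall x, f x = 0 \/ g x = 0) -> hdot f g = 0.
Proof.
move=> fg; apply: l2dot_unique.
rewrite [X in X @ _ --> _](_ : _ = cst 0).
  by apply: cvg_cst; exact: summability.totally_filter.
apply/funext => A; rewrite psumE big1// => x _.
by case: (fg x) => ->; rewrite ?rmorph0 ?mul0r ?mulr0.
Qed.

Fact l2cut_subproof P f : (fun x => if P x then f x else 0) \in @sqsummable R G.
Proof.
apply/sqsummableP; have [M HM] := l2_sqsum f; exists M => A.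
apply: le_trans (HM A); rewrite !psumE; apply: ler_sum => x _.
by case: ifP => // _; rewrite normr0 expr0n exprn_ge0.
Qed.

Definition l2cut P f : ell2 := L2 (l2cut_subproof P f).

Lemma l2cut_dot P f : hdot (l2cut P f) f = hdot (l2cut P f) (l2cut P f).
Proof.
apply/eqP; rewrite -subr_eq0 -hdotBr; apply/eqP/l2dot_disjoint => x.
rewrite [(f - _) x](_ : _ = f x - l2cut P f x)//=.
by case: ifP => _; [right; rewrite subrr|left].
Qed.

Lemma l2cut_dotr P f : hdot f (l2cut P f) = hdot (l2cut P f) (l2cut P f).
Proof. by rewrite hdot_conj l2cut_dot hdot_self_conj. Qed.

Lemma l2cut_compl_le P f : hdot (f - l2cut P f) (f - l2cut P f) <= hdot f f.
Proof.
rewrite hdotBl !hdotBr l2cut_dot l2cut_dotr subrr subr0.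
by rewrite lerBlDr lerDl hdot_ge0.
Qed.

(** Bessel's inequality: the sum S of the disjoint cuts is an orthogonal projection of f, so |f|^2 -
    |S|^2 = |f - S|^2. *)
Lemma sum_l2cut_le (N : nat) (P : 'I_N -> pred G) f :
  (forall i j x, i != j -> P i x -> ~~ P j x) ->
  \sum_i hdot (l2cut (P i) f) (l2cut (P i) f) <= hdot f f.
Proof.
move=> Pd; pose S := \sum_i l2cut (P i) f.
have SS : hdot S S = \sum_i hdot (l2cut (P i) f) (l2cut (P i) f).
  apply: hdot_sum_orthogonal => i j ij; apply: l2dot_disjoint => x /=.
  by have := Pd i j x ij; case: (P i x); [move=> /(_ isT)/negPf ->; right|left].
have Sf : hdot S f = hdot S S.
  by rewrite SS hdot_suml; apply: eq_bigr => i _; exact: l2cut_dot.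
have fS : hdot f S = hdot S S by rewrite hdot_conj Sf hdot_self_conj.
rewrite -SS -subr_ge0; have := hdot_ge0 (f - S).
by rewrite hdotBl !hdotBr fS Sf subrr subr0.
Qed.

(* Each [x i] maps the complement of the cell [{e = a i}] into the cell
   [{e = b i}], as for a family of free generators; this splits the operator
   into a part with orthogonal ranges and a part with orthogonal supports. *)
Lemma regular_rep_sum_bound (N : nat) (x : 'I_N -> G) (c : 'I_N -> C)
    (e : G -> int) (a b : 'I_N -> int) f :
  injective a -> injective b ->
  (forall i y, e y != a i -> e (x i * y)%g = b i) -> (forall i, `|c i| = 1) ->
  hdot (\sum_i c i *: regular_rep R G (x i) f) (\sum_i c i *: regular_rep R G (x i) f)
  <= 4 * N%:R * hdot f f.
Proof.
move=> ai bi ex c1; set h := \sum_i _.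
pose P i : pred G := fun y => e y == a i.
pose v i := c i *: regular_rep R G (x i) (l2cut (P i) f).
pose w i := c i *: regular_rep R G (x i) (f - l2cut (P i) f).
have norm1 i k : hdot (c i *: regular_rep R G (x i) k) (c i *: regular_rep R G (x i) k) = hdot k k.
  by rewrite hdotZZ c1 expr1n mul1r rep_unitary.
have -> : h = \sum_i v i + \sum_i w i.
  rewrite -big_split; apply: eq_bigr => i _.
  by rewrite [RHS](_ : _ = v i + w i)// -scalerDr -repD addrC subrK.
apply: le_trans (hdotD_le _ _) _.
(* One factor 2 comes from separating the two parts, the other from adding their bounds. *)
have -> : 4 * N%:R * hdot f f = 2 * (N%:R * hdot f f + N%:R * hdot f f) by ring.
rewrite ler_pM2l//; apply: lerD.
  (* The cuts of f have disjoint supports, hence total square at most |f|^2; summing N vectors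
     without control of their ranges costs a factor N. *)
  apply: le_trans (hdot_sum_le _) _; rewrite card_ord.
  apply: ler_wpM2l => //; under eq_bigr do rewrite /v norm1.
  apply: sum_l2cut_le => i j y ij; rewrite /P => /eqP ->.
  by apply: contra ij => /eqP/ai ->.
(* Here the ranges lie in disjoint cells, and each of the N orthogonal terms is bounded by |f|^2. *)
rewrite hdot_sum_orthogonal; last first.
  move=> i j ij; rewrite hdotZl hdotZr l2dot_disjoint ?mulr0// => y.
  have [yi|yi] := eqVneq (e ((x i)^-1 * y)%g) (a i).
    left; rewrite /= /translate /=.
    rewrite [LHS](_ : _ = f ((x i)^-1 * y)%g - l2cut (P i) f ((x i)^-1 * y)%g)//=.
    by rewrite /P yi eqxx subrr.
  have [yj|yj] := eqVneq (e ((x j)^-1 * y)%g) (a j).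
    right; rewrite /= /translate /=.
    rewrite [LHS](_ : _ = f ((x j)^-1 * y)%g - l2cut (P j) f ((x j)^-1 * y)%g)//=.
    by rewrite /P yj eqxx subrr.
  have := ex _ _ yj; rewrite mulVKg; have := ex _ _ yi; rewrite mulVKg => -> /bi ijE.
  by rewrite ijE eqxx in ij.
have -> : N%:R * hdot f f = \sum_(i < N) hdot f f by rewrite sumr_const card_ord mulr_natl.
by apply: ler_sum => i _; rewrite /w norm1; exact: l2cut_compl_le.
Qed.

End RegularRepresentationBound.

(** * Eigenvectors of tempered actions *)

Lemma complex_archimedean_eq0 (R : realType) (a b : R[i]) :
  0 <= a -> (forall N : nat, N.+1%:R * a <= b) -> a = 0.
Proof.
move=> a0 ab; have aR : a = (complex.Re a)%:C%C.
  by have /ger0_Im := a0; case: (a) => x y /= ->.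
have ra0 : 0 <= complex.Re a by rewrite -lecR -aR.
apply/eqP/negPn/negP => an0; have ra : 0 < complex.Re a.
  by rewrite lt_def ra0 andbT; apply: contra an0 => /eqP H; rewrite aR H.
pose x := `|complex.Re b| / complex.Re a.
have := ab (Num.bound x).
rewrite aR -(rmorph_nat (@real_complex R)) -rmorphM lecE => /andP[_] /=.
rewrite leNgt => /negP; apply; apply: le_lt_trans (ler_norm _) _.
rewrite -ltr_pdivrMr//; apply: (@lt_trans _ _ (Num.bound x)%:R); last by rewrite ltr_nat.
by rewrite archi_boundP// divr_ge0.
Qed.

Section TemperedAction.
Variables (R : realType) (G : groupType) (V : lmodType R[i]).
Variable form : {hermitian V for false & Num.conj}.
Hypothesis form_ge0 : forall v, 0 <= form v v.
Variable act : G -> V -> V.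
Hypotheses (act_linear : forall s, linear (act s)) (act1 : forall v, act 1%g v = v).
Hypothesis actM : forall s t v, act (s * t)%g v = act s (act t v).
Hypothesis act_isom : forall s v w, form (act s v) (act s w) = form v w.
Implicit Types (v w : V) (s t : G).
Local Notation C := R[i].
Local Notation null := (form_null form).

(* The bound satisfied by the vectors of a representation that is weakly
   contained in the regular representation, up to the constant [K]. *)
Definition tempered_vector v := exists K : C, forall (N : nat) (c : 'I_N -> C)
  (x : 'I_N -> G) (M : C), 0 <= M ->
  (forall f : ell2 R G,
     hdot (\sum_i c i *: regular_rep R G (x i) f) (\sum_i c i *: regular_rep R G (x i) f)
     <= M * hdot f f) ->
  form (\sum_i c i *: act (x i) v) (\sum_i c i *: act (x i) v) <= M * K.

Lemma iter_act s k v : iter k (act s) v = act (s ^+ k)%g v.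
Proof. by elim: k => [|k IH] /=; rewrite ?act1// IH -actM -expgS. Qed.

Let actB s v w : act s (v - w) = act s v - act s w.
Proof. by rewrite addrC -scaleN1r act_linear scaleN1r addrC. Qed.

Let actZ s a v : act s (a *: v) = a *: act s v.
Proof.
have a0 : act s 0 = 0 by have := actB s 0 0; rewrite !subrr.
by rewrite -[a *: v]addr0 act_linear a0 addr0.
Qed.

Let act_null s v : null v -> null (act s v).
Proof. by rewrite /form_null act_isom. Qed.

Lemma eigenvector_expg s z k v :
  eigenvector form (act s) z v -> null (act (s ^+ k)%g v - z ^+ k *: v).
Proof.
move=> vz; elim: k => [|k IH]; first by rewrite act1 scale1r subrr; exact: form_null0.
have -> : act (s ^+ k.+1)%g v - z ^+ k.+1 *: v =
    z ^+ k *: (act s v - z *: v) + act s (act (s ^+ k)%g v - z ^+ k *: v).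
  rewrite actB actZ scalerBr scalerA -exprSr expgS actM.
  by rewrite [RHS]addrC addrA subrK.
exact: (form_nullP form_ge0 _ vz (act_null _ IH)).
Qed.

Lemma eigenvector_gexpz s z j v : `|z| = 1 -> eigenvector form (act s) z v ->
  null (act (gexpz s j) v - z ^ j *: v).
Proof.
move=> z1 vz; case: j => k; first exact: eigenvector_expg.
have zk0 : z ^+ k.+1 != 0 by rewrite expf_neq0// -normr_eq0 z1 oner_eq0.
rewrite /form_null -(act_isom (s ^+ k.+1)%g) -/(form_null form _) actB actZ -actM /= mulgV act1.
have -> : v - z ^- k.+1 *: act (s ^+ k.+1)%g v =
    - z ^- k.+1 *: (act (s ^+ k.+1)%g v - z ^+ k.+1 *: v).
  by rewrite scalerBr !scaleNr opprK scalerA mulVf// scale1r addrC.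
by apply: form_nullZ => //; exact: eigenvector_expg.
Qed.

Section FreeGroup.
Variables (n : nat) (u : 'I_n -> G) (o : 'I_n).
Hypothesis freeG : free_group_on u.

Lemma tempered_eigenvector_orthogonal v w z z' s : tempered_vector v ->
  `|z| = 1 -> `|z'| = 1 ->
  eigenvector form (act (u o)) z v -> eigenvector form (act (u o)) z' w ->
  (forall j, s <> gexpz (u o) j) -> form (act s v) w = 0.
Proof.
move=> [K HK] z1 z1' vz wz /(exponent_outside freeG)[i [j ij]].
pose b := form (act s v) w; pose x k := (u o ^+ k * (s * u o ^+ k))%g.
have xv k : form (act (x k) v) w = (z' * z) ^+ k * b.
  rewrite actM; set y := act _ v.
  have E : form (act (u o ^+ k)%g y) w * (z' ^+ k)^* = form y w.
    rewrite -(act_isom (u o ^+ k)%g y) mulrC -hermZr.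
    exact/esym/(form_eq_r form_ge0 _ (eigenvector_expg k wz)).
  have -> : form (act (u o ^+ k)%g y) w = z' ^+ k * form y w.
    by rewrite -E mulrCA -normCK normrX z1' expr1n expr1n mulr1.
  rewrite exprMn -mulrA; congr (_ * _); rewrite /y actM -hermZl -actZ.
  by apply: form_eq_l => //; rewrite -actB; apply/act_null/eigenvector_expg.
suff : `|b| ^+ 2 = 0 by move/eqP; rewrite expf_eq0 normr_eq0 => /eqP.
(* Cauchy-Schwarz will give N^2 |b|^2 <= 4 N K <w, w>; one factor N cancels. *)
apply: (@complex_archimedean_eq0 _ _ (4 * K * form w w)); first exact: exprn_ge0.
move=> N'; set N := N'.+1.
pose c (k : 'I_N) : C := ((z' * z) ^+ k)^*.
pose h := \sum_k c k *: act (x k) v.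
have hw : form h w = N%:R * b.
  rewrite herm_suml (eq_bigr (fun=> b)); first by rewrite sumr_const card_ord mulr_natl.
  move=> k _; rewrite hermZl xv mulrA [c k * _]mulrC /c -normCK normrX normrM z1 z1'.
  by rewrite mulr1 !expr1n mul1r.
have := semi_CS form_ge0 h w; rewrite hw normrM normr_nat exprMn => H.
have hh : form h h <= 4 * N%:R * K.
  apply: HK; first by rewrite mulr_ge0.
  move=> f; apply: (@regular_rep_sum_bound _ _ _ _ _ (exponent freeG o)
    (fun k => j - k%:Z) (fun k => k%:Z + i)).
  - by move=> k l /addrI/oppr_inj[] /val_inj.
  - by move=> k l /addIr[] /val_inj.
  - move=> k y yk; rewrite /x -mulgA (exponent_gexpz freeG o k) -mulgA ij//.
    rewrite (exponent_gexpz freeG o k); apply: contra yk => /eqP <-.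
    by rewrite addrC addKr.
  - by move=> k; rewrite /c norm_conjC normrX normrM z1 z1' mulr1 expr1n.
have N0 : 0 < N%:R :> C by rewrite ltr0n.
rewrite -(ler_pM2l N0) mulrA -expr2; apply: le_trans H _.
rewrite (_ : _ * (4 * _ * _) = 4 * N%:R * K * form w w); last by ring.
exact: ler_wpM2r.
Qed.

End FreeGroup.
End TemperedAction.

(** * The group algebra *)

Section GroupAlgebraSums.
Variables (R : realType) (G : groupType).
Local Notation C := R[i].
Local Notation group_algebra := (@group_algebra R G).
Implicit Types (a b : G -> C) (s t : G) (c : C).

Lemma group_algebra_support a : group_algebra a ->
  exists A : {fset G}, forall s, s \notin A -> a s = 0.
Proof.
move=> fa; exists (fset_set [set s | a s != 0]) => s.
by rewrite in_fset_set// notin_setE /= => /negP/negPn/eqP.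
Qed.

Lemma support_group_algebra a (A : {fset G}) :
  (forall s, s \notin A -> a s = 0) -> group_algebra a.
Proof.
move=> aA; apply: (@sub_finite_set _ _ [set` A]); last exact: finite_fset.
by move=> s /= /eqP as0; apply/negPn/negP => /aA.
Qed.

Lemma group_algebraP c a b :
  group_algebra a -> group_algebra b -> group_algebra (c *: a + b).
Proof.
move=> /group_algebra_support[A aA] /group_algebra_support[B bB].
apply: (@support_group_algebra _ (A `|` B)%fset) => s; rewrite inE negb_or => /andP[sA sB].
by rewrite [LHS](_ : _ = c * a s + b s)// aA// bB// mulr0 addr0.
Qed.

Lemma group_algebra0 : group_algebra 0.
Proof. exact: (@support_group_algebra _ fset0). Qed.

Lemma group_algebraZ c a : group_algebra a -> group_algebra (c *: a).
Proof. by move=> ?; rewrite -[_ *: _]addr0; apply: group_algebraP group_algebra0. Qed.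

Lemma group_algebraD a b : group_algebra a -> group_algebra b -> group_algebra (a + b).
Proof. by move=> ? ?; rewrite -[a]scale1r; apply: group_algebraP. Qed.

Definition ga_delta s : G -> C := fun t => (t == s)%:R.

Lemma group_algebra_delta s : group_algebra (ga_delta s).
Proof.
apply: (@support_group_algebra _ [fset s]%fset) => t.
by rewrite inE /ga_delta => /negPf ->.
Qed.

Lemma group_algebra_sum (I : Type) (r : seq I) (F : I -> G -> C) :
  (forall i, group_algebra (F i)) -> group_algebra (\sum_(i <- r) F i).
Proof.
by move=> gF; elim/big_rec: _ => [|i a _ ga]; [exact: group_algebra0|exact: group_algebraD].
Qed.

Lemma ga_polyE (p : {poly C}) s :
  ga_poly p s = \sum_(k < size p) p`_k *: ga_delta (s ^+ k)%g.
Proof.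
apply/funext => t; rewrite fct_sumE; apply: eq_bigr => k _.
by rewrite [RHS](_ : _ = p`_k * (t == (s ^+ k)%g)%:R)// mulr_natr.
Qed.

Lemma group_algebra_translate s a : group_algebra a -> group_algebra (ga_translate s a).
Proof.
move=> /group_algebra_support[A aA].
apply: (@support_group_algebra _ [fset (s * x)%g | x in A]%fset) => t tA.
by apply: aA; apply: contra tA => tA; apply/imfsetP; exists (s^-1 * t)%g; rewrite ?mulVKg.
Qed.

Lemma group_algebra_star a : group_algebra a -> group_algebra (ga_star a).
Proof.
move=> /group_algebra_support[A aA].
apply: (@support_group_algebra _ [fset (x^-1)%g | x in A]%fset) => t tA.
rewrite /ga_star aA ?rmorph0//; apply: contra tA => tA; apply/imfsetP.
by exists (t^-1)%g; rewrite ?invgK.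
Qed.

Lemma ga_star_linear c a b : ga_star (c *: a + b) = c^* *: ga_star a + ga_star b.
Proof. by apply/funext => s; rewrite /ga_star rmorphD rmorphM. Qed.

Section Extension.
Variable V : lmodType C.
Implicit Types Psi : G -> V.

(** A common form of [ga_eval] (with values in C), [rep_alg] and, in its left argument, [ga_mul], so
    that linearity and reindexing are proved once. *)
Definition ga_ext Psi a : V := \sum_(s \in [set: G]) a s *: Psi s.

Lemma ga_extE Psi a (A : {fset G}) : (forall s, s \notin A -> a s = 0) ->
  ga_ext Psi a = \sum_(s <- A) a s *: Psi s.
Proof. by move=> aA; apply: fsbigTE => s /aA ->; rewrite scale0r. Qed.

Lemma ga_ext_linear Psi c a b : group_algebra a -> group_algebra b ->
  ga_ext Psi (c *: a + b) = c *: ga_ext Psi a + ga_ext Psi b.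
Proof.
move=> /group_algebra_support[A aA] /group_algebra_support[B bB].
have wA s : s \notin (A `|` B)%fset -> a s = 0 by rewrite inE negb_or => /andP[/aA].
have wB s : s \notin (A `|` B)%fset -> b s = 0 by rewrite inE negb_or => /andP[_ /bB].
rewrite (ga_extE _ wA) (ga_extE _ wB) (@ga_extE _ _ (A `|` B)%fset); last first.
  by move=> s sAB; rewrite [LHS](_ : _ = c * a s + b s)// wA// wB// mulr0 addr0.
rewrite scaler_sumr -big_split; apply: eq_bigr => s _ /=.
by rewrite scalerA -scalerDl.
Qed.

Lemma ga_ext0 Psi : ga_ext Psi 0 = 0.
Proof. by rewrite (@ga_extE _ _ fset0)// big_seq_fset0. Qed.

Lemma ga_extZ Psi c a : group_algebra a -> ga_ext Psi (c *: a) = c *: ga_ext Psi a.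
Proof.
by move=> ga; rewrite -[c *: a]addr0 ga_ext_linear ?ga_ext0 ?addr0//; exact: group_algebra0.
Qed.

Lemma ga_extD Psi a b : group_algebra a -> group_algebra b ->
  ga_ext Psi (a + b) = ga_ext Psi a + ga_ext Psi b.
Proof. by move=> ga gb; rewrite -[a]scale1r ga_ext_linear// !scale1r. Qed.

Lemma ga_ext_delta Psi s : ga_ext Psi (ga_delta s) = Psi s.
Proof.
rewrite (@ga_extE _ _ [fset s]%fset) ?big_seq_fset1 /ga_delta ?eqxx ?scale1r//.
by move=> t; rewrite inE => /negPf ->.
Qed.

Lemma ga_ext_sum Psi (I : Type) (r : seq I) (F : I -> G -> C) :
  (forall i, group_algebra (F i)) ->
  ga_ext Psi (\sum_(i <- r) F i) = \sum_(i <- r) ga_ext Psi (F i).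
Proof.
move=> gF; elim: r => [|i r IH]; first by rewrite !big_nil ga_ext0.
by rewrite !big_cons ga_extD ?IH//; exact: group_algebra_sum.
Qed.

Lemma ga_ext_poly Psi (p : {poly C}) s :
  ga_ext Psi (ga_poly p s) = \sum_(k < size p) p`_k *: Psi (s ^+ k)%g.
Proof.
rewrite ga_polyE ga_ext_sum; last by move=> k; exact/group_algebraZ/group_algebra_delta.
by apply: eq_bigr => k _; rewrite ga_extZ ?ga_ext_delta//; exact: group_algebra_delta.
Qed.

Lemma ga_ext_translate Psi s a :
  ga_ext Psi (ga_translate s a) = ga_ext (fun t => Psi (s * t)%g) a.
Proof.
rewrite /ga_ext (@reindex_fsbigT _ _ _ _ _ (fun t => (s * t)%g)) /=; last first.
  by exists (fun t => (s^-1 * t)%g) => t; rewrite ?mulKg ?mulVKg.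
by apply: eq_fsbigr => t _; rewrite /ga_translate mulKg.
Qed.

Lemma ga_ext_star Psi a :
  ga_ext Psi (ga_star a) = ga_ext (fun t => Psi t^-1%g) (fun t => (a t)^*).
Proof.
rewrite /ga_ext (@reindex_fsbigT _ _ _ _ _ (fun t : G => t^-1%g)) /=; last first.
  by exists (fun t : G => t^-1%g) => t; rewrite invgK.
by apply: eq_fsbigr => t _; rewrite /ga_star invgK.
Qed.

End Extension.

Lemma ga_mulE a b (A : {fset G}) : (forall s, s \notin A -> a s = 0) ->
  forall s, ga_mul a b s = \sum_(t <- A) a t * b (t^-1 * s)%g.
Proof. by move=> aA s; apply: fsbigTE => t /aA ->; rewrite mul0r. Qed.

Lemma ga_mul_support a b (A B : {fset G}) :
  (forall s, s \notin A -> a s = 0) -> (forall s, s \notin B -> b s = 0) ->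
  forall s, s \notin [fset (t * r)%g | t in A, r in B]%fset -> ga_mul a b s = 0.
Proof.
move=> aA bB s sAB; rewrite (ga_mulE _ aA) big_seq big1// => t tA.
rewrite bB ?mulr0//; apply: contra sAB => sB.
by apply/imfset2P; exists t => //; exists (t^-1 * s)%g; rewrite ?mulVKg.
Qed.

Lemma group_algebra_mul a b : group_algebra a -> group_algebra b ->
  group_algebra (ga_mul a b).
Proof.
move=> /group_algebra_support[A aA] /group_algebra_support[B bB].
exact: (support_group_algebra (ga_mul_support aA bB)).
Qed.

Lemma ga_ext_mul (V : lmodType C) (Psi : G -> V) a b :
  group_algebra a -> group_algebra b ->
  ga_ext Psi (ga_mul a b) = ga_ext (fun t => ga_ext (fun s => Psi (t * s)%g) b) a.
Proof.
move=> /group_algebra_support[A aA] /group_algebra_support[B bB].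
rewrite (ga_extE _ aA) (ga_extE _ (ga_mul_support aA bB)).
under eq_bigr do rewrite (ga_mulE _ aA) scaler_suml.
rewrite exchange_big /=; apply: eq_big_seq => t tA.
rewrite -ga_ext_translate (@ga_extE _ _ _ [fset (t * r)%g | t in A, r in B]%fset); last first.
  move=> s sAB; apply: bB; apply: contra sAB => sB.
  by apply/imfset2P; exists t => //; exists (t^-1 * s)%g; rewrite ?mulVKg.
by rewrite scaler_sumr; apply: eq_bigr => s _; rewrite scalerA.
Qed.

End GroupAlgebraSums.

Section RepresentationAlgebra.
Variables (R : realType) (G : groupType) (H : hilbert R) (pi : unirep G H).
Local Notation C := R[i].
Local Notation group_algebra := (@group_algebra R G).
Implicit Types (a b : G -> C) (x y : H).

Lemma rep_algE a x : rep_alg pi a x = ga_ext (fun s => pi s x) a.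
Proof. by []. Qed.

Lemma rep_alg_mul a b x : group_algebra a -> group_algebra b ->
  rep_alg pi (ga_mul a b) x = rep_alg pi a (rep_alg pi b x).
Proof.
move=> ga gb; rewrite !rep_algE ga_ext_mul//; apply: eq_fsbigr => t _.
have [B bB] := group_algebra_support gb.
rewrite !(ga_extE _ bB) rep_sum; congr (_ *: _); apply: eq_bigr => s _.
by rewrite repZ repM.
Qed.

Lemma rep_alg_translate s a x : group_algebra a ->
  rep_alg pi (ga_translate s a) x = pi s (rep_alg pi a x).
Proof.
move=> /group_algebra_support[A aA].
rewrite !rep_algE ga_ext_translate !(ga_extE _ aA) rep_sum.
by apply: eq_bigr => t _; rewrite repZ repM.
Qed.

Lemma rep_alg_adjoint a x y : group_algebra a ->
  hdot (rep_alg pi a x) y = hdot x (rep_alg pi (ga_star a) y).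
Proof.
move=> /group_algebra_support[A aA].
rewrite !rep_algE ga_ext_star (ga_extE _ aA) (@ga_extE _ _ _ _ _ A); last first.
  by move=> s /aA ->; rewrite rmorph0.
rewrite hdot_suml hdot_sumr; apply: eq_bigr => s _.
by rewrite hdotZl hdotZr conjCK rep_adjoint.
Qed.

Lemma rep_alg_linear a : group_algebra a -> linear (rep_alg pi a).
Proof.
move=> /group_algebra_support[A aA] c x y.
rewrite !rep_algE !(ga_extE _ aA) scaler_sumr -big_split; apply: eq_bigr => s _ /=.
by rewrite repD repZ scalerDr !scalerA mulrC.
Qed.

Lemma rep_alg_poly (p : {poly C}) s x :
  rep_alg pi (ga_poly p s) x = poly_act (pi s) p x.
Proof.
rewrite rep_algE ga_ext_poly; apply: eq_bigr => k _.
by rewrite (iter_act (rep1 pi) (repM pi)).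
Qed.

Lemma hdot_rep_alg a x y : group_algebra a ->
  hdot (rep_alg pi a x) y = ga_eval (fun s => hdot (pi s x) y) a.
Proof.
move=> /group_algebra_support[A aA]; rewrite rep_algE (ga_extE _ aA) hdot_suml.
rewrite /ga_eval (@fsbigTE _ _ _ _ A); last by move=> s /aA ->; rewrite mul0r.
by apply: eq_bigr => s _; rewrite hdotZl.
Qed.

Lemma rep_alg_dot a b x y : group_algebra a -> group_algebra b ->
  hdot (rep_alg pi a x) (rep_alg pi b y) =
  ga_eval (fun s => hdot (pi s x) y) (ga_mul (ga_star b) a).
Proof.
move=> ga gb; have gs := group_algebra_star gb.
rewrite -hdot_rep_alg; last exact: group_algebra_mul.
rewrite rep_alg_mul// [RHS]hdot_conj [LHS]hdot_conj; congr (_^*).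
by rewrite rep_alg_adjoint.
Qed.

End RepresentationAlgebra.

(** * Square roots of operators *)

Section GeometricConvergence.
Variable R : realType.
Local Notation C := R[i].

Lemma half_pow_le (n : nat) : n.+1%:R / 2 ^+ n <= 1 :> C.
Proof.
rewrite ler_pdivrMr ?exprn_gt0// mul1r -natrX ler_nat.
by elim: n => // n IH; rewrite expnS mul2n -addnn -addn1 leq_add// expn_gt0.
Qed.

Lemma half_pow_eq0 (a b : C) : 0 <= a -> (forall n : nat, a <= b / 2 ^+ n) -> a = 0.
Proof.
move=> a0 ab; have b0 : 0 <= b.
  by apply: le_trans a0 _; have := ab 0%N; rewrite expr0 divr1.
apply: (@complex_archimedean_eq0 _ _ b) => // n.
apply: le_trans (ler_wpM2l (ler0n _ _) (ab n)) _.
by rewrite mulrCA ler_piMr// half_pow_le.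
Qed.

Lemma half_pow_lt (b e : C) : 0 <= b -> 0 < e -> exists n : nat, b / 2 ^+ n <= e.
Proof.
move=> b0 e0; apply: contrapT => /forallNP H.
have : e = 0; last by move/eqP; rewrite gt_eqF.
apply: (@half_pow_eq0 _ b) => [|n]; first exact: ltW.
apply/ltW; rewrite real_ltNge; first exact/negP/H.
  exact: gtr0_real.
by apply: ger0_real; rewrite divr_ge0// exprn_ge0.
Qed.

(** The rate survives in the limit. For the square root it gives convergence in operator norm, and
    not merely at each vector. *)
Lemma geometric_cvg (V : completeNormedModType C) (y : nat -> V) (b : C) :
  0 <= b -> (forall n k, `|y (n + k)%N - y n| <= b / 2 ^+ n) ->
  exists l : V, forall n, `|l - y n| <= b / 2 ^+ n.
Proof.
move=> b0 yb.
have /cvg_ex[l yl] : cvg (y @ \oo).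
  apply: cauchy_cvg; apply: cauchy_exP => e e0.
  have e2 : 0 < e / 2 by rewrite divr_gt0.
  have [n bn] := half_pow_lt b0 e2.
  exists (y n); exists n => // m /= nm; rewrite -ball_normE /= distrC -(subnKC nm).
  apply: le_lt_trans (yb _ _) _; apply: le_lt_trans bn _.
  by rewrite ltr_pdivrMr// ltr_pMr// ltr1n.
exists l => n; apply/ler_addgt0Pl => e e0.
move/cvgrPdist_lt : yl => /(_ _ e0)[N _ HN].
have := HN (n + N)%N (leq_addl _ _) => /= lN.
rewrite -(subrK (y (n + N)%N) l) -addrA; apply: le_trans (ler_normD _ _) _.
by apply: lerD; [exact: ltW|exact: yb].
Qed.

End GeometricConvergence.

Section SquareRoot.
Variables (R : realType) (H : hilbert R) (X : H -> H).
Local Notation C := R[i].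
Hypotheses (X_linear : linear X) (X_sym : forall f g, hdot (X f) g = hdot f (X g)).
Hypothesis X_half : forall f, `|X f| <= `|f| / 2.
Implicit Types f g : H.

(* Visser's iteration: the fixed points [Y] of [Y |-> (X + Y^2) / 2] satisfy
   [(1 - Y)^2 = 1 - X]. *)
Fixpoint sqrt_iter (n : nat) (f : H) : H :=
  if n is m.+1 then 2^-1 *: (X f + sqrt_iter m (sqrt_iter m f)) else 0.

Lemma hdot_norm_le f g : `|hdot f g| <= `|f| * `|g|.
Proof.
rewrite -(@ler_pXn2r _ 2) ?nnegrE ?mulr_ge0// exprMn !hnormE !sqrtCK.
exact: hdot_CS.
Qed.

Let Y := sqrt_iter.

Let Y_linear n : linear (Y n).
Proof.
elim: n => [|n IH] c f g /=; first by rewrite scaler0 addr0.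
by rewrite X_linear -/Y !IH addrACA -scalerDr [LHS]scalerDr !scalerA mulrC.
Qed.

Let linearB (F : H -> H) : linear F -> forall f g, F (f - g) = F f - F g.
Proof. by move=> Fl f g; rewrite addrC -scaleN1r Fl scaleN1r addrC. Qed.

Let Y_half n f : `|Y n f| <= `|f| / 2.
Proof.
elim: n f => [|n IH] f /=; first by rewrite normr0 divr_ge0.
rewrite normrZ ger0_norm ?invr_ge0// mulrC ler_pM2r ?invr_gt0//.
apply: le_trans (ler_normD _ _) _; rewrite [leRHS]splitr.
apply: lerD; first exact: X_half.
apply: le_trans (IH _) _; rewrite ler_pM2r ?invr_gt0//; apply: le_trans (IH _) _.
by rewrite ler_pdivrMr// ler_peMr// ler1n.
Qed.

Let Y_sym n f g : hdot (Y n f) g = hdot f (Y n g).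
Proof.
elim: n f g => [|n IH] f g /=; first by rewrite linear0l linear0r.
rewrite hdotZl hdotZr hdotDl hdotDr -/Y !IH X_sym.
by rewrite fmorphV/= rmorph_nat.
Qed.

(** A difference of squares without commutativity: A^2 - B^2 = A (A - B) + (A - B) B. As A and B
    have norm at most 1/2, each iteration halves the increment. *)
Let Y_step n f : `|Y n.+1 f - Y n f| <= `|f| / 2 ^+ n.+1.
Proof.
elim: n f => [|n IH] f.
  rewrite /= subr0 addr0 expr1 normrZ ger0_norm ?invr_ge0// mulrC ler_pM2r ?invr_gt0//.
  by apply: le_trans (X_half f) _; rewrite ler_pdivrMr// ler_peMr// ler1n.
have -> : Y n.+2 f - Y n.+1 f =
    2^-1 *: (Y n.+1 (Y n.+1 f - Y n f) + (Y n.+1 (Y n f) - Y n (Y n f))).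
  rewrite (linearB (Y_linear n.+1)) addrA subrK.
  have -> : Y n.+2 f = 2^-1 *: (X f + Y n.+1 (Y n.+1 f)) by [].
  have {2}-> : Y n.+1 f = 2^-1 *: (X f + Y n (Y n f)) by [].
  by rewrite -scalerBr opprD addrACA subrr add0r.
rewrite normrZ ger0_norm ?invr_ge0// mulrC exprSr invfM mulrA ler_pM2r ?invr_gt0//.
apply: le_trans (ler_normD _ _) _; rewrite [leRHS]splitr; apply: lerD.
  by apply: le_trans (Y_half _ _) _; rewrite ler_pM2r ?invr_gt0.
apply: le_trans (IH _) _.
rewrite [leRHS]mulrAC ler_pM2r ?invr_gt0 ?exprn_gt0//; exact: Y_half.
Qed.

Let Y_cauchy f n k : `|Y (n + k)%N f - Y n f| <= `|f| / 2 ^+ n.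
Proof.
(* Subtracting the tail of the geometric series makes the induction on k close. *)
have : `|Y (n + k)%N f - Y n f| <= `|f| / 2 ^+ n - `|f| / 2 ^+ (n + k).
  elim: k => [|k IH]; first by rewrite addn0 !subrr normr0.
  rewrite addnS -(subrK (Y (n + k)%N f) (Y (n + k).+1 f)) -addrA.
  apply: le_trans (ler_normD _ _) _.
  apply: le_trans (lerD (Y_step _ _) IH) _.
  rewrite (_ : `|f| / 2 ^+ (n + k) = `|f| / 2 ^+ (n + k).+1 + `|f| / 2 ^+ (n + k).+1).
    by rewrite addrCA opprD addNKr.
  by rewrite exprSr invfM mulrA -splitr.
by move=> /le_trans; apply; rewrite gerBl divr_ge0// exprn_ge0.
Qed.

(** T is 1 - L, with L the limit of the iterates. The last clause bounds the distance from T to 1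
    minus an iterate uniformly in f; the iterates being polynomials in X, it keeps T in the norm
    closure of any algebra with unit containing X. *)
Lemma sqrt_one_minus : exists T : H -> H,
  [/\ linear T, forall f g, hdot (T f) g = hdot f (T g),
      forall f, T (T f) = f - X f &
      forall n f, `|T f - (f - sqrt_iter n f)| <= `|f| / 2 ^+ n].
Proof.
have /choice[L LY] : forall f, exists l : H, forall n, `|l - Y n f| <= `|f| / 2 ^+ n.
  by move=> f; apply: geometric_cvg => // n k; exact: Y_cauchy.
(* Each property of L is inherited from the iterates by bounding a defect by a multiple of 2^-n. *)
have small0 v b : (forall n, `|v| <= b / 2 ^+ n) -> v = 0 :> H.
  by move=> vb; apply/normr0_eq0/(half_pow_eq0 (normr_ge0 v) vb).
have L_linear : linear L.
  move=> c f g; apply/eqP; rewrite -subr_eq0; apply/eqP.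
  apply: (small0 _ (`|c *: f + g| + (`|c| * `|f| + `|g|))) => n.
  have -> : L (c *: f + g) - (c *: L f + L g) =
      (L (c *: f + g) - Y n (c *: f + g)) - (c *: (L f - Y n f) + (L g - Y n g)).
    rewrite Y_linear scalerBr addrACA -opprD opprB.
    by rewrite addrA subrK.
  apply: le_trans (ler_normB _ _) _; rewrite !mulrDl; apply: lerD => //.
  apply: le_trans (ler_normD _ _) _; apply: lerD => //.
  by rewrite normrZ -mulrA ler_wpM2l.
have L_sym f g : hdot (L f) g = hdot f (L g).
  apply/eqP; rewrite -subr_eq0 -normr_eq0; apply/eqP.
  apply: (@half_pow_eq0 _ _ (2 * (`|f| * `|g|))) => // n.
  have -> : hdot (L f) g - hdot f (L g) = hdot (L f - Y n f) g - hdot f (L g - Y n g).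
    by rewrite hdotBl hdotBr Y_sym opprB addrA subrK.
  apply: le_trans (ler_normB _ _) _; rewrite mulrDl mul1r mulrDl.
  apply: lerD; apply: le_trans (hdot_norm_le _ _) _.
    by rewrite mulrAC ler_wpM2r.
  by rewrite -mulrA ler_wpM2l.
(* The equation 2 L = X + L^2 is what turns (1 - L)^2 into 1 - X. *)
have L_fix f : L f = 2^-1 *: (X f + L (L f)).
  apply/eqP; rewrite -subr_eq0; apply/eqP.
  apply: (small0 _ (`|f| + (`|f| + `|L f|))) => n.
  have -> : L f - 2^-1 *: (X f + L (L f)) = (L f - Y n.+1 f) -
     2^-1 *: (Y n (L f - Y n f) + (L (L f) - Y n (L f))).
    have -> : Y n.+1 f = 2^-1 *: (X f + Y n (Y n f)) by [].
    rewrite (linearB (Y_linear n)) -addrA -opprD -scalerDr; congr (_ - _ *: _).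
    rewrite [X in _ = _ + X](_ : _ = L (L f) - Y n (Y n f)); last first.
      by rewrite addrC addrA subrK.
    by rewrite -addrA (addrC (Y n (Y n f))) subrK.
  apply: le_trans (ler_normB _ _) _; rewrite mulrDl; apply: lerD.
    apply: le_trans (LY _ _) _; rewrite exprS invfM mulrA ler_pM2r ?invr_gt0 ?exprn_gt0//.
    by rewrite ler_pdivrMr// ler_peMr// ler1n.
  rewrite normrZ ger0_norm ?invr_ge0// ler_pdivrMl//.
  apply: (@le_trans _ _ (1 * ((`|f| + `|L f|) / 2 ^+ n))); last first.
    by rewrite ler_wpM2r ?ler1n// divr_ge0 ?addr_ge0// exprn_ge0.
  rewrite mul1r mulrDl; apply: le_trans (ler_normD _ _) _; apply: lerD => //.
  apply: le_trans (Y_half _ _) _; rewrite ler_pdivrMr//.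
  by apply: le_trans (LY _ _) _; rewrite ler_peMr ?ler1n// divr_ge0// exprn_ge0.
exists (fun f => f - L f); split.
- move=> c f g; rewrite L_linear scalerBr opprD -!addrA; congr (_ + _).
  by rewrite addrCA.
- by move=> f g; rewrite hdotBl hdotBr L_sym.
- move=> f; rewrite (linearB L_linear) opprB.
  have E : X f + L (L f) = L f + L f.
    have := congr1 (fun v => 2 *: v) (L_fix f); rewrite scalerA divff// scale1r => <-.
    by rewrite scaler_nat mulr2n.
  have -> : X f = L f + L f - L (L f) by rewrite -E addrK.
  by rewrite opprB opprD !addrA [f - L f + _]addrAC.
- by move=> n f; rewrite opprB addrC addrA subrK distrC.
Qed.

End SquareRoot.

(** * Reduced states *)

Section ReducedStateBound.
Variables (R : realType) (G : groupType).
Local Notation C := R[i].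
Local Notation group_algebra := (@group_algebra R G).
Local Notation ell2 := (ell2 R G).
Local Notation lambda := (rep_alg (regular_rep R G)).
Implicit Types (a b x : G -> C) (phi : G -> C).

Lemma ga_eval_linear phi (c : C) a b : group_algebra a -> group_algebra b ->
  ga_eval phi (c *: a + b) = c * ga_eval phi a + ga_eval phi b.
Proof. exact: (@ga_ext_linear _ _ C^o). Qed.

Lemma ga_eval_delta phi s : ga_eval phi (ga_delta R s) = phi s.
Proof. exact: (@ga_ext_delta _ _ C^o). Qed.

Lemma rep_alg_comb (H : hilbert R) (pi : unirep G H) (c : C) a b (f : H) :
  group_algebra a -> group_algebra b ->
  rep_alg pi (c *: a + b) f = c *: rep_alg pi a f + rep_alg pi b f.
Proof. by move=> ga gb; rewrite !rep_algE ga_ext_linear. Qed.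

Lemma ga_starK a : ga_star (ga_star a) = a.
Proof. by apply/funext => s; rewrite /ga_star invgK conjCK. Qed.

Lemma rep_alg_is_adjoint a : group_algebra a -> is_adjoint (lambda a) (lambda (ga_star a)).
Proof. by move=> ga f g; exact: rep_alg_adjoint. Qed.

Lemma reduced_Cstar_rep_alg a : group_algebra a -> reduced_Cstar (lambda a).
Proof.
move=> ga; split; first exact: rep_alg_linear.
by move=> e e0; exists a => // f; rewrite subrr normr0 mulr_ge0// ltW.
Qed.

Lemma is_reduced_ge0 phi a : is_reduced phi -> group_algebra a ->
  0 <= ga_eval phi (ga_mul (ga_star a) a).
Proof.
move=> [Phi [_ Phi_ge0 PhiE]] ga; have gs := group_algebra_star ga.
rewrite -PhiE; last exact: group_algebra_mul.
rewrite (_ : lambda _ = lambda (ga_star a) \o lambda a).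
  by apply: Phi_ge0; [exact: reduced_Cstar_rep_alg|exact: rep_alg_is_adjoint].
by apply/funext => f; rewrite /= rep_alg_mul.
Qed.

(** An adjoint has the same norm: for g = a^* f, Cauchy-Schwarz gives <g, g>^2 = |<a g, f>|^2 <= M
    <g, g> <f, f>, and <g, g> cancels when nonzero. *)
Lemma rep_alg_star_bound a (M : C) : 0 <= M -> group_algebra a ->
  (forall f : ell2, hdot (lambda a f) (lambda a f) <= M * hdot f f) ->
  forall f : ell2, hdot (lambda (ga_star a) f) (lambda (ga_star a) f) <= M * hdot f f.
Proof.
move=> M0 ga aM f; set g := lambda (ga_star a) f.
have [g0|g0] := eqVneq (hdot g g) 0; first by rewrite g0 mulr_ge0// hdot_ge0.
have gp : 0 < hdot g g by rewrite lt_def g0 hdot_ge0.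
rewrite -(ler_pM2r gp); have := hdot_CS (lambda a g) f.
rewrite rep_alg_adjoint// -/g => H.
rewrite -expr2 -[hdot g g]ger0_norm ?hdot_ge0//; apply: le_trans H _.
rewrite ger0_norm ?hdot_ge0// mulrAC; apply: ler_wpM2r; first exact: hdot_ge0.
exact: aM.
Qed.

Lemma sqrt_iter_group_algebra x n : group_algebra x ->
  exists2 b, group_algebra b & sqrt_iter (lambda x) n = lambda b.
Proof.
move=> gx; elim: n => [|n [b gb IH]].
  exists 0; first exact: group_algebra0.
  by apply/funext => f; rewrite rep_algE ga_ext0.
have gbb : group_algebra (ga_mul b b) by exact: group_algebra_mul.
exists (2^-1 *: (x + ga_mul b b)); first exact/group_algebraZ/group_algebraD.
apply/funext => f /=; rewrite IH !rep_algE ga_extZ; last exact: group_algebraD.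
by rewrite ga_extD// -!rep_algE rep_alg_mul.
Qed.

(** With X = a^* a / (2 M), the operator 1 - X is the square of a self-adjoint T in the reduced
    C*-algebra. Positivity on [T \o T] reads phi (a^* a) / (2 M) <= phi 1. *)
Let is_reduced_bound_gt0 phi a (M : C) : is_reduced phi -> group_algebra a -> 0 < M ->
  (forall f : ell2, hdot (lambda a f) (lambda a f) <= M * hdot f f) ->
  ga_eval phi (ga_mul (ga_star a) a) <= 2 * M * phi 1%g.
Proof.
move=> [Phi [_ Phi_ge0 PhiE]] ga M0 aM; have gs := group_algebra_star ga.
have gm : group_algebra (ga_mul (ga_star a) a) by exact: group_algebra_mul.
pose c : C := (2 * M)^-1; pose x := c *: ga_mul (ga_star a) a.
have M2 : 0 < 2 * M by rewrite mulr_gt0.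
have c0 : 0 < c by rewrite invr_gt0.
have gx : group_algebra x by exact: group_algebraZ.
have xE f : lambda x f = c *: lambda (ga_star a) (lambda a f).
  by rewrite rep_algE ga_extZ// -rep_algE rep_alg_mul.
have cr : c^* = c by apply: CrealP; exact: gtr0_real.
have x_sym (f g : ell2) : hdot (lambda x f) g = hdot f (lambda x g).
  by rewrite !xE hdotZl hdotZr cr rep_alg_adjoint// ga_starK rep_alg_adjoint.
have x_half (f : ell2) : `|lambda x f| <= `|f| / 2.
  rewrite -(@ler_pXn2r _ 2) ?nnegrE ?divr_ge0// expr_div_n.
  rewrite !hnormE !sqrtCK xE hdotZZ (ger0_norm (ltW c0)).
  have H := rep_alg_star_bound (ltW M0) ga aM (lambda a f).
  have {}H : hdot (lambda (ga_star a) (lambda a f)) (lambda (ga_star a) (lambda a f))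
    <= M * (M * hdot f f).
    by apply: le_trans H _; rewrite ler_pM2l.
  apply: le_trans (ler_wpM2l (exprn_ge0 2 (ltW c0)) H) _.
  rewrite le_eqVlt; apply/orP; left; apply/eqP.
  by rewrite /c; field; rewrite gt_eqF.
have [T [T_lin T_sym TT T_iter]] := sqrt_one_minus (rep_alg_linear _ gx) x_sym x_half.
have g1 : group_algebra (ga_delta R 1%g) := group_algebra_delta R 1%g.
have T_red : reduced_Cstar T.
  split=> // e e0; have [n ne] := half_pow_lt ler01 e0.
  have [b gb bE] := sqrt_iter_group_algebra n gx.
  exists ((-1) *: b + ga_delta R 1%g); first exact: group_algebraP.
  move=> f; rewrite (_ : lambda _ f = f - sqrt_iter (lambda x) n f).
    by apply: le_trans (T_iter n f) _; rewrite mulrC ler_wpM2r// -[_^-1]mul1r.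
  rewrite rep_alg_comb// -bE scaleN1r addrC [rep_alg _ (ga_delta R _) f]rep_algE.
  by rewrite ga_ext_delta rep1.
have TTE : T \o T = lambda ((-1) *: x + ga_delta R 1%g).
  apply/funext => f /=; rewrite TT rep_alg_comb// [rep_alg _ (ga_delta R _) f]rep_algE.
  by rewrite ga_ext_delta rep1 scaleN1r addrC.
have := Phi_ge0 T T T_red T_sym; rewrite TTE PhiE; last exact: group_algebraP.
rewrite ga_eval_linear// ga_eval_delta mulN1r addrC subr_ge0.
rewrite (_ : ga_eval phi x = c * ga_eval phi (ga_mul (ga_star a) a)); last first.
  exact: (@ga_extZ _ _ C^o).
by rewrite /c ler_pdivrMl.
Qed.

Lemma is_reduced_bound phi a (M : C) : is_reduced phi -> group_algebra a -> 0 <= M ->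
  (forall f : ell2, hdot (lambda a f) (lambda a f) <= M * hdot f f) ->
  0 <= phi 1%g -> ga_eval phi (ga_mul (ga_star a) a) <= 2 * M * phi 1%g.
Proof.
move=> phi_red ga M0 aM phi1; apply/ler_addgt0Pr => e e0.
(* The bound for M + d exceeds the one for M by 2 d phi(1) <= e; the added 1 keeps the denominator
   positive. *)
pose d := e / (2 * (phi 1%g + 1)).
have d0 : 0 < d by rewrite divr_gt0// mulr_gt0// ltr_wpDl.
apply: le_trans (is_reduced_bound_gt0 phi_red ga (_ : 0 < M + d) _) _.
- by rewrite ltr_wpDl.
- by move=> f; apply: le_trans (aM f) _; rewrite mulrDl lerDl mulr_ge0 ?hdot_ge0// ltW.
rewrite mulrDr mulrDl lerD2l /d.
have p0 : 0 < phi 1%g + 1 by rewrite ltr_wpDl.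
rewrite (_ : 2 * _ * phi 1%g = e * (phi 1%g / (phi 1%g + 1))); last first.
  by field; rewrite gt_eqF.
apply: ler_piMr; first exact: ltW.
by rewrite ler_pdivrMr// mul1r lerDl.
Qed.

End ReducedStateBound.

(** Over complex scalars positivity alone forces symmetry: the squares of w + v and of 'i w + v are
    real. This makes [state_form] hermitian. *)
Lemma semidefinite_hermitian (C : numClosedFieldType) (V : lmodType C) (h : V -> V -> C) :
  bilinear_for *%R (Num.conj \; *%R) h -> (forall v, 0 <= h v v) ->
  forall v w, h v w = (h w v)^*.
Proof.
move=> [hl hr] h0 v w.
have hDZ (c : C) : h (c *: w + v) (c *: w + v) =
    (c * c^* * h w w + h v v) + (c * h w v + c^* * h v w).
  rewrite [LHS](hl _ c w v) (hr w c w v) (hr v c w v) /=.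
  by rewrite mulrDr mulrA [RHS](AC (2*2) (1*3*4*2))/= -!addrA.
have hvr (x : V) : (h x x)^* = h x x by apply: CrealP; exact: ger0_real.
have R1 : (h w v + h v w)^* = h w v + h v w.
  have := hvr (1 *: w + v); rewrite hDZ rmorph1 !mul1r rmorphD/= rmorphD/= !hvr.
  by move/addrI.
have R2 : ('i * h w v - 'i * h v w)^* = 'i * h w v - 'i * h v w.
  have := hvr ('i *: w + v); rewrite hDZ conjCi rmorphD/= rmorphD/= rmorphM/= rmorphM/= rmorphN/= conjCi.
  by rewrite opprK !hvr (mulrC 'i (- 'i)) (mulNr _ (h v w)) => /addrI.
have i0 : 'i != 0 :> C by exact: neq0Ci.
have R3 : (h v w)^* - (h w v)^* = h w v - h v w.
  apply: (mulfI i0); rewrite !mulrBr -R2 rmorphB/= !rmorphM/= conjCi !mulNr opprK.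
  by rewrite addrC.
have R4 : (h v w)^* + (h w v)^* = h w v + h v w by rewrite addrC -rmorphD.
have : 2 * h v w = 2 * (h w v)^*.
  rewrite (_ : 2 * h v w = (h w v + h v w) - (h w v - h v w)); last by ring.
  by rewrite -R3 -R4; ring.
by apply: mulfI; rewrite pnatr_eq0.
Qed.

(** * The group algebra with the inner product of a reduced state *)

Section GroupAlgebraType.
Variables (R : realType) (G : groupType).
Local Notation C := R[i].

Definition finsupp_pred : {pred G -> C} := mem (@group_algebra R G).

Lemma finsupp_predP a : reflect (group_algebra a) (a \in finsupp_pred).
Proof. by apply: (iffP idP) => [/set_mem|/mem_set]. Qed.

Fact finsupp_submod_closed : submod_closed finsupp_pred.
Proof.
split; first exact/finsupp_predP/group_algebra0.
by move=> c a b /finsupp_predP ga /finsupp_predP gb; exact/finsupp_predP/group_algebraP.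
Qed.
HB.instance Definition _ := GRing.isSubmodClosed.Build C (G -> C) finsupp_pred
  finsupp_submod_closed.

(** The results on forms apply to a whole module, whereas the sums over G are linear on finitely
    supported functions; hence a type for these. *)
Record galg := GAlg { gval :> G -> C; gval_in : gval \in finsupp_pred }.
HB.instance Definition _ := [isSub for gval].
HB.instance Definition _ := [Choice of galg by <:].
HB.instance Definition _ := [SubChoice_isSubLmodule of galg by <:].

Lemma gvalP (a : galg) : group_algebra a.
Proof. exact/finsupp_predP/gval_in. Qed.

Definition galg_of a (ga : @group_algebra R G a) : galg := GAlg (introT (finsupp_predP a) ga).

Definition gact (s : G) (a : galg) : galg := galg_of (group_algebra_translate s (gvalP a)).

Definition gunit : galg := galg_of (group_algebra_delta R (1%g : G)).

Lemma gact_linear s : linear (gact s).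
Proof. by move=> c a b; apply/val_inj/funext. Qed.

Lemma gact1 a : gact 1%g a = a.
Proof. by apply/val_inj/funext => t /=; rewrite /ga_translate invg1 mul1g. Qed.

Lemma gactM s t a : gact (s * t)%g a = gact s (gact t a).
Proof. by apply/val_inj/funext => r /=; rewrite /ga_translate invgM mulgA. Qed.

Lemma gval_sum (I : Type) (r : seq I) (F : I -> galg) :
  gval (\sum_(i <- r) F i) = \sum_(i <- r) gval (F i).
Proof. exact: (big_morph gval (fun _ _ => erefl) erefl). Qed.

Lemma ga_mul_linearr x (c : C) a b : @group_algebra R G x ->
  ga_mul x (c *: a + b) = c *: ga_mul x a + ga_mul x b.
Proof.
move=> /group_algebra_support[A xA]; apply/funext => s.
rewrite [RHS](_ : _ = c * ga_mul x a s + ga_mul x b s)// !(ga_mulE _ xA).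
rewrite mulr_sumr -big_split; apply: eq_bigr => t _ /=.
by rewrite [X in _ * X](_ : _ = c * a (t^-1 * s)%g + b (t^-1 * s)%g)//; ring.
Qed.

Lemma ga_mul_linearl x (c : C) a b : @group_algebra R G a -> @group_algebra R G b ->
  ga_mul (c *: a + b) x = c *: ga_mul a x + ga_mul b x.
Proof.
by move=> ga gb; apply/funext => s; exact: (@ga_ext_linear _ _ C^o (fun t => x (t^-1 * s)%g)).
Qed.

Section ReducedForm.
Variables (psi : G -> C) (psi_red : is_reduced psi).

Definition state_form (a b : galg) : C := ga_eval psi (ga_mul (ga_star b) a).

Lemma state_form_ge0 a : 0 <= state_form a a.
Proof. exact/is_reduced_ge0/gvalP. Qed.

Let state_form_bilinear : bilinear_for *%R (Num.conj \; *%R) state_form.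
Proof.
split=> [b c a a'|a c b b']; have gs := fun b : galg => group_algebra_star (gvalP b).
  rewrite /state_form [gval (_ + _)](_ : _ = c *: gval a + gval a')// ga_mul_linearr//.
  by rewrite ga_eval_linear//; apply: group_algebra_mul => //; exact: gvalP.
rewrite /state_form [gval (_ + _)](_ : _ = c *: gval b + gval b')// ga_star_linear.
rewrite ga_mul_linearl// ga_eval_linear//; apply: group_algebra_mul => //; exact: gvalP.
Qed.

HB.instance Definition _ := @bilinear_isBilinear.Build C galg galg C *%R
  (Num.conj \; *%R) state_form state_form_bilinear.
Let state_form_hermitian a b : state_form a b = (-1) ^+ false * (state_form b a)^*.
Proof.
by rewrite expr0 mul1r; exact: (semidefinite_hermitian state_form_bilinear state_form_ge0).
Qed.
HB.instance Definition _ :=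
  @isHermitianSesquilinear.Build C galg false Num.conj state_form state_form_hermitian.

Lemma gact_isom s a b : state_form (gact s a) (gact s b) = state_form a b.
Proof.
rewrite /state_form; congr ga_eval; apply/funext => r /=.
rewrite /ga_mul (@reindex_fsbigT _ _ _ _ _ (fun t => (t * s^-1)%g)) /=; last first.
  by exists (fun t => (t * s)%g) => t; rewrite ?mulgK ?mulgVK.
apply: eq_fsbigr => t _; rewrite /ga_star /ga_translate !invgM !invgK.
by rewrite mulKg -mulgA mulKg.
Qed.

Let form : {hermitian galg for false & Num.conj} := state_form.

Lemma rep_alg_bounded a : @group_algebra R G a -> exists2 B : C, 0 <= B &
  forall f : ell2 R G,
    hdot (rep_alg (regular_rep R G) a f) (rep_alg (regular_rep R G) a f) <= B * hdot f f.
Proof.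
move=> /group_algebra_support[A aA]; pose B : C := \sum_(s <- A) `|a s|.
have nE (f : ell2 R G) : hdot f f = `|f| ^+ 2 by rewrite hnormE sqrtCK.
have B0 : 0 <= B by apply: sumr_ge0.
exists (B ^+ 2) => [|f]; first exact: exprn_ge0.
rewrite !nE -exprMn lerXn2r ?nnegrE ?mulr_ge0//.
rewrite rep_algE (ga_extE _ aA) mulr_suml; apply: le_trans (ler_norm_sum _ _ _) _.
apply: ler_sum => s _; rewrite normrZ ler_wpM2l//.
by rewrite !hnormE rep_unitary.
Qed.

(** Left multiplication of [a] by a combination of group elements acts on l^2 as that combination
    after [a], so the squared norm is at most M times the bound B for [a]. *)
Lemma galg_tempered a : 0 <= psi 1%g -> tempered_vector form gact a.
Proof.
move=> psi1; have [B B0 aB] := rep_alg_bounded (gvalP a).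
exists (2 * B * psi 1%g) => N c x M M0 cM.
set h := \sum_i _.
have hE f : rep_alg (regular_rep R G) h f =
    \sum_i c i *: regular_rep R G (x i) (rep_alg (regular_rep R G) a f).
  rewrite /h gval_sum rep_algE ga_ext_sum => [|i]; last exact: gvalP.
  apply: eq_bigr => i _; rewrite -rep_alg_translate; last exact: gvalP.
  by rewrite -ga_extZ//; apply: group_algebra_translate; exact: gvalP.
have -> : M * (2 * B * psi 1%g) = 2 * (M * B) * psi 1%g by ring.
apply: is_reduced_bound => //; [exact: gvalP|exact: mulr_ge0|].
move=> f; rewrite hE; apply: le_trans (cM _) _.
by rewrite -mulrA ler_wpM2l.
Qed.

Lemma state_formE s : state_form (gact s gunit) gunit = psi s.
Proof.
rewrite /state_form -[ga_eval _ _]/(@ga_ext _ _ C^o psi _) ga_ext_mul; last 2 first.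
- exact/group_algebra_star/gvalP.
- exact: gvalP.
have -> : ga_star gunit = ga_delta R 1%g.
  apply/funext => t; rewrite /ga_star /= /ga_delta conjC_nat.
  by rewrite -[X in _ == X]invg1 (inj_eq invg_inj) .
by rewrite ga_ext_delta ga_ext_translate ga_ext_delta mul1g mulg1.
Qed.

Lemma gval_poly_act (p : {poly C}) s : gval (poly_act (gact s) p gunit) = ga_poly p s.
Proof.
rewrite ga_polyE gval_sum; apply: eq_bigr => k _.
rewrite (iter_act gact1 gactM) /=; congr (_ *: _); apply/funext => t.
rewrite /ga_translate /ga_delta; congr (_%:R).
by rewrite -(inj_eq (mulgI (s ^+ k)%g)) mulVKg mulg1.
Qed.

(** The unit of the group algebra is a sum of eigenvectors f z modulo null vectors, so psi s is the
    sum of all <s (f z), f w>. Only the terms with z = w on the unit circle survive, and they equal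
    |f z|^2 chi_z(s). Evaluation at 1 shows that the weights sum to 1. *)
Lemma reduced_state_convex_combination (n : nat) (u : 'I_n -> G) (o : 'I_n)
    (freeG : free_group_on u) (p : {poly C}) : p != 0 -> psi 1%g = 1 ->
  ga_eval psi (ga_mul (ga_star (ga_poly p (u o))) (ga_poly p (u o))) = 0 ->
  exists (m : nat) (t : 'I_m -> C) (z : 'I_m -> C),
    [/\ forall i, 0 <= t i,
        \sum_(i < m) t i = 1,
        forall i, `|z i| = 1 /\ root p (z i) &
        forall s, psi s = \sum_(i < m) t i * chi (u o) (z i) s].
Proof.
move=> p0 psi1 pnull; have ge0 : forall a, 0 <= form a a := state_form_ge0.
have [rs pE] := closed_field_poly_normal p.
pose U := gact (u o); pose S := undup rs.
have lp0 : lead_coef p != 0 by rewrite lead_coef_eq0.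
have Unull : form_null form (poly_act U p gunit).
  by rewrite /form_null /= /state_form gval_poly_act.
rewrite pE in Unull.
have rsS : {subset rs <= S} by move=> z; rewrite mem_undup.
have [f [fS fE]] := eigenvector_decomposition ge0 (gact_linear (u o))
  (gact_isom (u o)) (undup_uniq rs) rsS lp0 Unull.
have tv a : tempered_vector form gact a by apply: galg_tempered; rewrite psi1.
have root_S z : z \in S -> root p z.
  by rewrite mem_undup pE rootZ// root_prod_XsubC.
have psiE s : psi s = \sum_(z <- S) \sum_(w <- S) form (gact s (f z)) (f w).
  rewrite -state_formE -/(form _ _) (form_eq_r ge0 _ fS) herm_sumr exchange_big /=.
  apply: eq_bigr => w _.
  have -> : form (gact s gunit) (f w) = form (gact s (\sum_(z <- S) f z)) (f w).
    apply: (form_eq_l ge0); have := form_null_isom (form := form) (gact_isom s) fS.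
    by rewrite addrC -scaleN1r gact_linear scaleN1r addrC.
  rewrite (_ : gact s _ = \sum_(z <- S) gact s (f z)); first exact: herm_suml.
  apply: (big_morph (gact s)) => [a b|]; last exact/val_inj/funext.
  by rewrite -[a]scale1r gact_linear !scale1r.
pose t z := form (f z) (f z).
have cross s z w : z \in S -> w \in S -> form (gact s (f z)) (f w) =
    if (`|z| == 1) && (w == z) then t z * chi (u o) z s else 0.
  move=> zS wS; have [z1|z1] /= := eqVneq `|z| 1; last first.
    apply: (form_null_l ge0); apply: (form_null_isom (form := form) (gact_isom s)).
    exact: (eigenvector_null ge0 (gact_isom (u o)) (fE z zS) z1).
  have [w1|w1] := eqVneq `|w| 1; last first.
    rewrite form_null_r//; last exact: (eigenvector_null ge0 (gact_isom (u o)) (fE w wS) w1).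
    by case: eqP => // wz; rewrite wz z1 eqxx in w1.
  have [[j ->]|sG1] := pselect (exists j, s = gexpz (u o) j).
    rewrite (form_eq_l ge0 _ (eigenvector_gexpz ge0 gact_linear gact1 gactM gact_isom
      j z1 (fE z zS))) hermZl chi_gexpz//.
    case: eqVneq => [->|wz]; first by rewrite mulrC.
    rewrite (eigenvector_orthogonal ge0 (gact_isom (u o)) w1 _ (fE z zS) (fE w wS)) ?mulr0//.
    by rewrite eq_sym.
  have sN j : s <> gexpz (u o) j by move=> sj; apply: sG1; exists j.
  rewrite chi_outside// mulr0 if_same.
  exact: (tempered_eigenvector_orthogonal ge0 gact_linear gact1 gactM gact_isom freeG
    (tv (f z)) z1 w1 (fE z zS) (fE w wS)).
pose S1 := [seq z <- S | `|z| == 1].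
have psiS1 s : psi s = \sum_(z <- S1) t z * chi (u o) z s.
  rewrite psiE big_filter [RHS]big_mkcond; apply: eq_big_seq => z zS.
  rewrite (bigD1_seq z) ?undup_uniq//= cross// eqxx andbT big1_seq ?addr0//.
  by move=> w /andP[wz wS]; rewrite cross// (negPf wz) andbF.
exists (size S1), (fun i => t S1`_i), (fun i => S1`_i).
have inS1 (i : 'I_(size S1)) : S1`_i \in S1 by rewrite mem_nth.
split=> [i|||s].
- exact: ge0.
- rewrite -psi1 psiS1 [RHS](big_nth 0) big_mkord; apply: eq_bigr => i _.
  by rewrite -[X in chi _ _ X]/(gexpz (u o) 0) chi_gexpz// mulr1.
- by move=> i; have := inS1 i; rewrite mem_filter => /andP[/eqP -> /root_S].
- by rewrite psiS1 (big_nth 0) big_mkord.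
Qed.

End ReducedForm.
End GroupAlgebraType.

(** * Closed subspaces of Hilbert spaces *)

Section ClosedSubspaces.
Variables (R : realType) (H : hilbert R).
Local Notation C := R[i].
Implicit Types (A K : set H) (x y : H).

Lemma closure_normP A x :
  closure A x <-> forall e : C, 0 < e -> exists2 y, A y & `|x - y| < e.
Proof.
split=> [Ax e e0|Ax B /nbhs_ballP[e /= e0 eB]].
  have [y [Ay]] := Ax _ (nbhsx_ballx x e e0).
  by rewrite -ball_normE /= => xy; exists y.
by have [y Ay xy] := Ax e e0; exists y; split=> //; apply: eB; rewrite -ball_normE.
Qed.

Lemma closed_normP A x : closed A ->
  (forall e : C, 0 < e -> exists2 y, A y & `|x - y| < e) -> A x.
Proof. by move=> Ac Ax; rewrite (iffLR (closure_id A) Ac); exact/closure_normP. Qed.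

Lemma hdotE x : hdot x x = `|x| ^+ 2.
Proof. by rewrite hnormE sqrtCK. Qed.

Lemma hdot_eq0 x : hdot x x = 0 -> x = 0.
Proof. by rewrite hdotE => /eqP; rewrite expf_eq0 normr_eq0 => /eqP. Qed.

Lemma rep_norm (G : groupType) (pi : unirep G H) s x : `|pi s x| = `|x|.
Proof. by rewrite !hnormE rep_unitary. Qed.

Lemma hdot_closure_eq0 A y x :
  (forall x, A x -> hdot x y = 0) -> closure A x -> hdot x y = 0.
Proof.
move=> Ay /closure_normP Ax; apply/eqP; rewrite -normr_eq0; apply/eqP.
apply: (@half_pow_eq0 _ _ `|y|) => // n.
have n0 : 0 < (2 ^+ n)^-1 :> C by rewrite invr_gt0 exprn_gt0.
have [x' Ax' xx'] := Ax _ n0.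
rewrite -[x](subrK x') hdotDl (Ay x')// addr0 mulrC.
apply: le_trans (hdot_norm_le _ _) _; apply: ler_wpM2r => //; exact: ltW.
Qed.

Lemma closed_subspaceD K x y : closed_subspace K -> K x -> K y -> K (x + y).
Proof. by move=> [_ _ Kl] Kx Ky; rewrite -[x]scale1r; exact: Kl. Qed.

Lemma closed_subspaceZ K (c : C) x : closed_subspace K -> K x -> K (c *: x).
Proof. by move=> [_ K0 Kl] Kx; rewrite -[c *: x]addr0; exact: Kl. Qed.

Lemma closed_subspaceB K x y : closed_subspace K -> K x -> K y -> K (x - y).
Proof.
move=> Ks Kx Ky; apply: closed_subspaceD => //; rewrite -scaleN1r.
exact: closed_subspaceZ.
Qed.

Lemma closed_subspace_sum K (I : Type) (r : seq I) (P : pred I) (F : I -> H) :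
  closed_subspace K -> (forall i, P i -> K (F i)) -> K (\sum_(i <- r | P i) F i).
Proof.
move=> Ks KF; elim/big_rec: _ => [|i x Pi Kx]; first by case: Ks.
by apply: closed_subspaceD => //; exact: KF.
Qed.

Lemma closed_span_subspace A : closed_subspace (closed_span A).
Proof.
split.
- by apply: closed_bigI => K [[]].
- by move=> K [[]].
- by move=> c x y Ax Ay K [Ks AK]; case: (Ks) => _ _; apply; [apply: Ax|apply: Ay].
Qed.

Lemma closure_closed_subspace A : A 0 ->
  (forall (c : C) x y, A x -> A y -> A (c *: x + y)) -> closed_subspace (closure A).
Proof.
move=> A0 Al; split; [exact: closed_closure|exact: subset_closure|].
move=> c x y /closure_normP Ax /closure_normP Ay; apply/closure_normP => e e0.
have c1 : 0 < `|c| + 1 by rewrite ltr_wpDl.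
have d0 : 0 < e / 2 / (`|c| + 1) by rewrite !divr_gt0.
have e2 : 0 < e / 2 by rewrite divr_gt0.
have [x' Ax' xx'] := Ax _ d0; have [y' Ay' yy'] := Ay _ e2.
exists (c *: x' + y'); first exact: Al.
rewrite opprD addrACA -scalerBr [X in _ < X]splitr.
apply: le_lt_trans (ler_normD _ _) _; apply: ler_ltD => //.
rewrite normrZ; apply: (@le_trans _ _ (`|c| * (e / 2 / (`|c| + 1)))).
  by rewrite ler_wpM2l// ltW.
rewrite mulrCA ler_piMr ?(ltW e2)// ler_pdivrMr// mul1r lerDl //.
Qed.

(** This allows invariance of a closed span to be checked on generators. *)
Lemma rep_preimage_subspace (G : groupType) (pi : unirep G H) K s :
  closed_subspace K -> closed_subspace [set x | K (pi s x)].
Proof.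
move=> [Kc K0 Kl]; split.
- apply/closure_id/seteqP; split=> [|x /closure_normP Kx]; first exact: subset_closure.
  apply: (closed_normP Kc) => e e0; have [y Ky xy] := Kx e e0; exists (pi s y) => //.
  by rewrite -scaleN1r -repZ -repD scaleN1r rep_norm.
- by rewrite /= rep0.
- by move=> c x y Kx Ky /=; rewrite rep_linear; exact: Kl.
Qed.

Lemma hdot_sub_proj x y : hdot y y != 0 ->
  hdot (x - (hdot x y / hdot y y) *: y) (x - (hdot x y / hdot y y) *: y) =
  hdot x x - `|hdot x y| ^+ 2 / hdot y y.
Proof.
move=> y0; rewrite hdotBl !hdotBr !hdotZl !hdotZr rmorphM/= fmorphV/= hdot_self_conj.
by rewrite (hdot_conj y x) normCK; field.
Qed.

Lemma hdot_parallelogram x y :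
  hdot (y - x) (y - x) = 2 * (hdot x x + hdot y y) - hdot (x + y) (x + y).
Proof. by rewrite hdotBl !hdotBr hdotDl !hdotDr; ring. Qed.

(** A minimizing sequence for the distance to K, within 4^-n of the infimum of the squared
    distances, is Cauchy at rate 2^-n by the parallelogram law. *)
Lemma hilbert_projection K x : closed_subspace K ->
  exists2 x0, K x0 & forall y, K y -> hdot (x - x0) y = 0.
Proof.
move=> Ks; have [Kc K0 Kl] := Ks.
have toR (v : H) : hdot v v = (complex.Re (hdot v v))%:C%C.
  by have /ger0_Im := hdot_ge0 v; case: (hdot v v) => a b /= ->.
pose E := [set complex.Re (hdot (x - y) (x - y)) | y in K].
have E_inf : has_inf E.
  split; first by exists (complex.Re (hdot (x - 0) (x - 0))), 0.
  by exists 0 => _ [y _ <-]; rewrite -lecR -toR hdot_ge0.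
pose d : C := (inf E)%:C%C.
have d_le y : K y -> d <= hdot (x - y) (x - y).
  move=> Ky; rewrite toR lecR; apply: ge_inf; first by case: E_inf.
  by exists y.
have /choice[y yP] : forall n : nat, exists y, K y /\
    hdot (x - y) (x - y) <= d + (2 ^+ n)^-1 ^+ 2.
  move=> n; have n0 : 0 < (2 ^+ n)^-1 ^+ 2 :> R by rewrite exprn_gt0// invr_gt0 exprn_gt0.
  have [_ [y Ky <-] yE] := inf_adherent n0 E_inf.
  exists y; split=> //; rewrite toR.
  rewrite (_ : d + _ = (inf E + (2 ^+ n)^-1 ^+ 2)%:C%C); first by rewrite lecR ltW.
  by rewrite rmorphD rmorphXn fmorphV rmorphXn rmorph_nat.
(* Moving y n along w could lower the squared distance by |<x - y n, w>|^2 / |w|^2, which cannot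
   exceed the remaining gap 4^-n. *)
have y_orth n w : K w -> `|hdot (x - y n) w| <= `|w| / 2 ^+ n.
  move=> Kw; have [Ky yd] := yP n.
  have [->|w0] := eqVneq w 0; first by rewrite linear0r !normr0 mul0r.
  have ww : 0 < hdot w w by rewrite hdotE exprn_gt0// normr_gt0.
  pose t := hdot (x - y n) w / hdot w w.
  have := d_le (t *: w + y n) (Kl t w (y n) Kw Ky).
  rewrite (_ : x - _ = (x - y n) - t *: w); last by rewrite opprD addrCA addrC.
  set v := x - y n in t yd *.
  rewrite /t hdot_sub_proj ?gt_eqF//.
  move=> dv; have : `|hdot v w| ^+ 2 / hdot w w <= (2 ^+ n)^-1 ^+ 2.
    move: dv; rewrite lerBrDr => /le_trans/(_ yd).
    by rewrite lerD2l.
  rewrite ler_pdivrMr// => H1.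
  rewrite -(@ler_pXn2r _ 2) ?nnegrE ?divr_ge0 ?exprn_ge0// exprMn -hdotE mulrC.
  exact: H1.
have y_cauchy n k : `|y (n + k)%N - y n| <= 2 / 2 ^+ n.
  have [Ka ad] := yP (n + k)%N; have [Kb bd] := yP n.
  set a := x - y (n + k)%N in ad; set b := x - y n in bd.
  (* The midpoint lies in K, so |a + b|^2 is at least 4 d and cancels the main term of 2 (|a|^2 +
     |b|^2). *)
  pose m := 2^-1 *: (y (n + k)%N + y n).
  have Km : K m by apply: closed_subspaceZ => //; exact: closed_subspaceD.
  have abm : a + b = 2 *: (x - m).
    rewrite scalerBr /m scalerA divff// scale1r scaler_nat mulr2n opprD.
    by rewrite /a /b addrACA.
  have ab : hdot (b - a) (b - a) = 2 * (hdot a a + hdot b b) - hdot (a + b) (a + b).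
    exact: hdot_parallelogram.
  have bE : y (n + k)%N - y n = b - a.
    by rewrite /a /b opprB [RHS]addrC addrA subrK.
  rewrite -(@ler_pXn2r _ 2) ?nnegrE ?divr_ge0 ?exprn_ge0// bE -hdotE ab abm hdotZZ.
  have r2 : `|2 : C| ^+ 2 = 4 by rewrite normr_nat -natrX.
  rewrite r2 lerBlDr.
  have H4 : 4 * d <= 4 * hdot (x - m) (x - m) by rewrite ler_pM2l//; exact: d_le.
  have H2 : 2 * (hdot a a + hdot b b) <=
      2 * ((d + (2 ^+ (n + k))^-1 ^+ 2) + (d + (2 ^+ n)^-1 ^+ 2)).
    by rewrite ler_pM2l//; exact: lerD.
  have H3 : (2 ^+ (n + k))^-1 ^+ 2 <= (2 ^+ n)^-1 ^+ 2 :> C.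
    rewrite lerXn2r ?nnegrE ?invr_ge0 ?exprn_ge0// lef_pV2 ?posrE ?exprn_gt0//.
    by rewrite ler_weXn2l ?ler1n// leq_addr.
  apply: le_trans H2 _; apply: le_trans (_ : _ <= (2 / 2 ^+ n) ^+ 2 + 4 * d) _.
    rewrite exprMn (_ : 2 * _ = 2 * ((2 ^+ (n + k))^-1 ^+ 2 + (2 ^+ n)^-1 ^+ 2) + 4 * d); last by ring.
    rewrite lerD2r expr2 -mulrA ler_pM2l// mulrDl mul1r lerD2r //.
  by rewrite lerD2l.
have [x0 yx0] := geometric_cvg (ler0n _ 2) y_cauchy.
exists x0.
  apply: closed_normP => // e e0.
  have e2 : 0 < e / 2 by rewrite divr_gt0.
  have [n ne] := half_pow_lt (ler0n C 2) e2.
  exists (y n); first by case: (yP n).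
  apply: le_lt_trans (yx0 n) _; apply: le_lt_trans ne _.
  by rewrite ltr_pdivrMr// ltr_pMr// ltr1n.
move=> w Kw; apply/eqP; rewrite -normr_eq0; apply/eqP.
apply: (@half_pow_eq0 _ _ (`|w| + 2 * `|w|)) => // n.
rewrite -(subrK (y n) x) -addrA hdotDl mulrDl.
apply: le_trans (ler_normD _ _) _; apply: lerD; first exact: y_orth.
apply: le_trans (hdot_norm_le _ _) _; rewrite mulrAC ler_wpM2r// distrC.
exact: yx0.
Qed.

End ClosedSubspaces.

(** * Representations weakly contained in the regular representation *)

Section WeakContainment.
Variables (R : realType) (G : groupType) (H : hilbert R) (pi : unirep G H).
Local Notation C := R[i].
Local Notation group_algebra := (@group_algebra R G).

Lemma hdot_rep_sum (H' : hilbert R) (sigma : unirep G H') (N : nat) (c : 'I_N -> C)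
    (x : 'I_N -> G) (v : H') :
  hdot (\sum_i c i *: sigma (x i) v) (\sum_i c i *: sigma (x i) v) =
  \sum_i \sum_j c i * (c j)^* * hdot (sigma ((x j)^-1 * x i)%g v) v.
Proof.
rewrite hdot_suml; apply: eq_bigr => i _; rewrite hdot_sumr; apply: eq_bigr => j _.
by rewrite hdotZl hdotZr mulrA repM [in RHS]rep_adjoint invgK.
Qed.

(** The square to be bounded is a finite combination of coefficients <pi(s) v, v>. Replacing them by
    sums of coefficients of the regular representation gives a quantity bounded by M phi(1), with
    phi(1) close to <v, v>. *)
Lemma weakly_contained_tempered v :
  weakly_contained pi (regular_rep R G) -> tempered_vector (@hdot R H) pi v.
Proof.
move=> wc; exists (hdot v v) => N c x M M0 cM; apply/ler_addgt0Pr => e e0.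
pose D : C := \sum_i \sum_j `|c i| * `|c j|.
have D0 : 0 <= D by apply: sumr_ge0 => i _; apply: sumr_ge0 => j _; rewrite mulr_ge0.
have MD0 : 0 < M + D + 1 by rewrite ltr_wpDl// addr_ge0.
(* The total error is at most (D + M) d <= e. *)
pose d := e / (M + D + 1); have d0 : 0 < d by rewrite divr_gt0.
(* The element 1 is included to control phi(1), the sum of the squares of the approximating
   vectors. *)
pose Q : set G := [set 1%g] `|` [set ((x p.2)^-1 * x p.1)%g | p in [set: 'I_N * 'I_N]].
have Qfin : finite_set Q.
  rewrite finite_setU; split; first exact: finite_set1.
  exact/finite_image/finite_finset.
have [m [y yQ]] := wc v Q d Qfin d0.
pose phi s := \sum_(k < m) hdot (regular_rep R G s (y k)) (y k).
have phi_near s : Q s -> `|hdot (pi s v) v - phi s| < d by exact: yQ.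
pose S := \sum_(k < m) hdot (\sum_i c i *: regular_rep R G (x i) (y k))
  (\sum_i c i *: regular_rep R G (x i) (y k)).
have SE : S = \sum_i \sum_j c i * (c j)^* * phi ((x j)^-1 * x i)%g.
  rewrite /S (eq_bigr _ (fun k _ => hdot_rep_sum (regular_rep R G) c x (y k))).
  rewrite exchange_big; apply: eq_bigr => i _ /=.
  by rewrite exchange_big; apply: eq_bigr => j _; rewrite -mulr_sumr.
have S_le : S <= M * (hdot v v + d).
  apply: (@le_trans _ _ (M * phi 1%g)).
    by rewrite /phi mulr_sumr; apply: ler_sum => k _; rewrite rep1; exact: cM.
  rewrite ler_wpM2l// -lerBlDl.
  have phi1 : 0 <= phi 1%g by apply: sumr_ge0 => k _; rewrite rep1 hdot_ge0.
  have := phi_near 1%g (or_introl erefl); rewrite rep1 distrC => /ltW; apply: le_trans.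
  by apply: real_ler_norm; rewrite rpredB// ger0_real// hdot_ge0.
pose h := hdot (\sum_i c i *: pi (x i) v) (\sum_i c i *: pi (x i) v).
rewrite -[X in X <= _]/h.
have h0 : 0 <= h by exact: hdot_ge0.
have S0 : 0 <= S by apply: sumr_ge0 => k _; exact: hdot_ge0.
have hS : h - S <= D * d.
  apply: le_trans (real_ler_norm _) _; first by rewrite rpredB// ger0_real.
  rewrite /h hdot_rep_sum SE -sumrB /D mulr_suml; apply: le_trans (ler_norm_sum _ _ _) _.
  apply: ler_sum => i _; rewrite -sumrB mulr_suml; apply: le_trans (ler_norm_sum _ _ _) _.
  apply: ler_sum => j _; rewrite -mulrBr !normrM norm_conjC ler_wpM2l ?mulr_ge0//.
  by apply/ltW/phi_near; right; exists (i, j).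
rewrite -(subrK S h); apply: le_trans (lerD hS S_le) _.
rewrite mulrDr addrCA lerD2l -mulrDl addrC /d mulrCA ler_piMr ?(ltW e0)//.
by rewrite ler_pdivrMr// mul1r lerDl.
Qed.

Section FreeGroup.
Variables (n : nat) (u : 'I_n -> G) (o : 'I_n) (p : {poly C}).
Hypotheses (freeG : free_group_on u) (p0 : p != 0).
Hypothesis pi_wc : weakly_contained pi (regular_rep R G).

Let tempered v : tempered_vector (@hdot R H) pi v := weakly_contained_tempered v pi_wc.

Let eigen (z : C) (v : H) := pi (u o) v = z *: v.

Let eigenP z v : eigen z v -> eigenvector (@hdot R H) (pi (u o)) z v.
Proof. by move=> vz; rewrite /eigenvector /form_null vz subrr linear0l. Qed.

Let eigen_gexpz z v j : `|z| = 1 -> eigen z v -> pi (gexpz (u o) j) v = z ^ j *: v.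
Proof.
move=> z1 /eigenP vz; apply/eqP; rewrite -subr_eq0; apply/eqP/hdot_eq0.
exact: (eigenvector_gexpz (@hdot_ge0 R H) (rep_linear pi) (rep1 pi) (repM pi)
  (rep_unitary pi) j z1 vz).
Qed.

Let eigen_outside z w v v' s : `|z| = 1 -> `|w| = 1 -> eigen z v -> eigen w v' ->
  (forall j, s <> gexpz (u o) j) -> hdot (pi s v) v' = 0.
Proof.
move=> z1 w1 /eigenP vz /eigenP vw.
exact: (tempered_eigenvector_orthogonal (@hdot_ge0 R H) (rep_linear pi) (rep1 pi) (repM pi)
  (rep_unitary pi) freeG (tempered v) z1 w1 vz vw).
Qed.

Let cyclic (e : H) : set H := closure ((fun a => rep_alg pi a e) @` group_algebra).

Let rep_alg_delta1 e : rep_alg pi (ga_delta R 1%g) e = e.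
Proof. by rewrite rep_algE ga_ext_delta rep1. Qed.

Let cyclic_generator e : cyclic e e.
Proof.
apply: subset_closure; exists (ga_delta R 1%g); first exact: group_algebra_delta.
exact: rep_alg_delta1.
Qed.

Let cyclic_subrep e : subrep pi (cyclic e).
Proof.
split.
  apply: closure_closed_subspace.
    by exists 0; [exact: group_algebra0|rewrite rep_algE ga_ext0].
  move=> c _ _ [a ga <-] [b gb <-]; exists (c *: a + b); first exact: group_algebraP.
  exact: rep_alg_comb.
move=> s x /closure_normP ex; apply/closure_normP => d d0.
have [_ [a ga <-] xa] := ex _ d0; exists (pi s (rep_alg pi a e)).
  exists (ga_translate s a); first exact: group_algebra_translate.
  exact: rep_alg_translate.
by rewrite -scaleN1r -repZ -repD scaleN1r rep_norm.
Qed.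

(** The coefficient <s e, e> is chi_z: on the powers of u_o by the eigenvalue equation, elsewhere by
    the orthogonality theorem applied to e and itself. *)
Let cyclic_GNS z e : `|z| = 1 -> eigen z e -> hdot e e = 1 ->
  is_GNS pi (cyclic e) (chi (u o) z).
Proof.
move=> z1 ez e1; exists (fun a => rep_alg pi a e); split => //.
- by move=> c a b ga gb; exact: rep_alg_comb.
- move=> a b ga gb; rewrite (rep_alg_dot pi e e ga gb).
  rewrite (_ : (fun s => hdot (pi s e) e) = chi (u o) z)//; apply/funext => s.
  have [[j ->]|sG1] := pselect (exists j, s = gexpz (u o) j).
    by rewrite (eigen_gexpz _ z1 ez) hdotZl e1 mulr1 chi_gexpz.
  have sN j : s <> gexpz (u o) j by move=> sj; apply: sG1; exists j.
  by rewrite chi_outside// (eigen_outside z1 z1 ez ez sN).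
- by move=> s a ga; rewrite rep_alg_translate.
Qed.

(** Orthogonality of e and e' suffices, even for equal eigenvalues: it gives <s e, e'> = 0 on the
    powers of u_o, and the other s contribute 0 anyway. *)
Let cyclic_orthogonal z w e e' x y : `|z| = 1 -> `|w| = 1 -> eigen z e -> eigen w e' ->
  hdot e e' = 0 -> cyclic e x -> cyclic e' y -> hdot x y = 0.
Proof.
move=> z1 w1 ez ew ee' ex ey; apply: hdot_closure_eq0 ex => _ [a ga <-].
rewrite hdot_conj (hdot_closure_eq0 _ ey) ?rmorph0// => _ [b gb <-].
rewrite hdot_conj rep_alg_dot// (_ : (fun s => _) = fun=> 0).
  by rewrite /ga_eval fsbig1 ?rmorph0// => s _; rewrite mulr0.
apply/funext => s; have [[j ->]|sG1] := pselect (exists j, s = gexpz (u o) j).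
  by rewrite (eigen_gexpz _ z1 ez) hdotZl ee' mulr0.
by apply: (eigen_outside z1 w1) => // j sj; apply: sG1; exists j.
Qed.

Let ker : set H := [set x | rep_alg pi (ga_poly p (u o)) x = 0].

Let eigen_ker z e : eigen z e -> root p z -> ker e.
Proof.
move=> ez /eqP pz; rewrite /ker /= rep_alg_poly /poly_act.
have E k : iter k (pi (u o)) e = z ^+ k *: e.
  by elim: k => [|k IH]; rewrite /= ?scale1r// IH repZ ez scalerA -exprSr.
under eq_bigr do rewrite E scalerA.
by rewrite -scaler_suml -horner_coef pz scale0r.
Qed.

Let good (A : set H) := (forall e, A e -> hdot e e = 1 /\
    exists z, [/\ `|z| = 1, root p z & eigen z e]) /\
  (forall e e', A e -> A e' -> e <> e' -> hdot e e' = 0).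

Lemma weakly_contained_direct_sum :
  exists (I : Type) (z : I -> C) (W : I -> set H),
    [/\ forall i, `|z i| = 1 /\ root p (z i),
        forall i, is_GNS pi (W i) (chi (u o) (z i)) &
        is_direct_sum pi (subrep_span pi ker) W].
Proof.
have [A [[A1 Ao] Amax]] : exists A, good A /\ forall B, A `<` B -> ~ good B.
  apply: Zorn_bigcup => F Fgood Ftot; split.
    by move=> e [X FX Xe]; exact: (Fgood X FX).1.
  move=> e e' [X FX Xe] [Y FY Ye']; have [XY|YX] := Ftot _ _ FX FY.
    by apply: (Fgood Y FY).2 => //; exact: XY.
  by apply: (Fgood X FX).2 => //; exact: YX.
(* Indexing by the vectors themselves lets the same eigenvalue occur with multiplicity. *)
pose I := {e : H | A e}.
have /choice[z zP] : forall i : I, exists z, [/\ `|z| = 1, root p z & eigen z (sval i)].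
  by move=> [e Ae]; have [_] := A1 e Ae.
pose W (i : I) := cyclic (sval i).
have z1 i : `|z i| = 1 by case: (zP i).
have zr i : root p (z i) by case: (zP i).
have ze i : eigen (z i) (sval i) by case: (zP i).
exists I, z, W; split=> //.
  by move=> i; apply: cyclic_GNS => //; case: i => e Ae /=; case: (A1 e Ae).
split; first by move=> i; exact: cyclic_subrep.
  move=> i j x y ij; apply: (cyclic_orthogonal (z1 i) (z1 j)) => //.
  apply: Ao; [exact: (svalP i)|exact: (svalP j)|move=> E; apply: ij].
  by move: i j E => [e Ae] [e' Ae'] /= E; exact: eq_exist.
pose K := closed_span (\bigcup_i W i); rewrite -/K.
have Ks : closed_subspace K by exact: closed_span_subspace.
have WK i : W i `<=` K.
  by move=> x Wx; apply: sub_gen_smallest; exists i.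
have Kinv s x : K x -> K (pi s x).
  apply: (smallest_sub (rep_preimage_subspace pi s Ks)) => {}x [i _ Wx] /=.
  by apply: (WK i); exact: (cyclic_subrep (sval i)).2.
(* The component of y orthogonal to K is again an eigenvector; if nonzero, it could be normalized
   and added to A. *)
have Keigen w y : `|w| = 1 -> root p w -> eigen w y -> K y.
  move=> w1 wr yw; have [y0 Ky0 yo] := hilbert_projection y Ks.
  pose y1 := y - y0; have y1w : eigen w y1.
    apply/eqP; rewrite -subr_eq0; apply/eqP/hdot_eq0.
    set v := pi (u o) y1 - w *: y1.
    (* The defect v lies in K, and it is also orthogonal to K because K is invariant under the
       inverse of u_o; hence it vanishes. *)
    have Kv : K v.
      rewrite (_ : v = w *: y0 - pi (u o) y0); last first.
        rewrite /v /y1 repD -scaleN1r repZ scaleN1r yw scalerBr opprB.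
        by rewrite scaleN1r addrC addrA subrK.
      by apply: (closed_subspaceB Ks); [exact: (closed_subspaceZ _ Ks)|exact: Kinv].
    rewrite {1}/v hdotBl hdotZl rep_adjoint !yo ?mulr0 ?subr0//.
    exact: Kinv.
  have [y10|y10] := eqVneq y1 0.
    by move: Ky0; rewrite -(subrK y0 y) -/y1 y10 add0r.
  have n0 : `|y1| != 0 by rewrite normr_eq0.
  pose e' := `|y1|^-1 *: y1.
  have e'1 : hdot e' e' = 1.
    by rewrite hdotE normrZ normfV normr_id mulVf// expr1n.
  have e'w : eigen w e' by rewrite /eigen repZ y1w !scalerA mulrC.
  have e'K k : K k -> hdot e' k = 0 by move=> Kk; rewrite hdotZl yo// mulr0.
  have AK e : A e -> K e by move=> Ae; apply: (WK (exist _ e Ae)); exact: cyclic_generator.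
  have := Amax (A `|` [set e']); case.
    split=> [e Ae|AB]; first by left.
    have := e'K e' (AK _ (AB e' (or_intror erefl))); rewrite e'1 => /eqP.
    by rewrite oner_eq0.
  split=> [e [/A1//|->]|e1 e2 [Ae1|->] [Ae2|->] // ne]; first by split=> //; exists w.
  - exact: Ao.
  - by rewrite hdot_conj e'K ?rmorph0//; exact: AK.
  - by rewrite e'K//; exact: AK.
have Kker x : ker x -> K x.
  rewrite /ker /= rep_alg_poly => px.
  have [rs pE] := closed_field_poly_normal p.
  have lp0 : lead_coef p != 0 by rewrite lead_coef_eq0.
  rewrite pE in px.
  have pnull : form_null (@hdot R H) (poly_act (pi (u o))
      (lead_coef p *: \prod_(r <- rs) ('X - r%:P)) x).
    by rewrite /form_null px linear0l.
  have rsS : {subset rs <= undup rs} by move=> r; rewrite mem_undup.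
  have [f [fS fE]] := eigenvector_decomposition (@hdot_ge0 R H) (rep_linear pi (u o))
    (rep_unitary pi (u o)) (undup_uniq rs) rsS lp0 pnull.
  rewrite (_ : x = \sum_(r <- undup rs) f r); last first.
    by apply/eqP; rewrite -subr_eq0; apply/eqP/hdot_eq0.
  rewrite big_seq; apply: (closed_subspace_sum _ Ks) => r rS.
  have [r1|r1] := eqVneq `|r| 1.
    apply: (Keigen r) => //.
      by rewrite pE rootZ// root_prod_XsubC -mem_undup.
    by apply/eqP; rewrite -subr_eq0; apply/eqP/hdot_eq0; exact: fE.
  rewrite (_ : f r = 0); first by case: Ks.
  apply: hdot_eq0; exact: (eigenvector_null (@hdot_ge0 R H) (rep_unitary pi (u o)) (fE r rS) r1).
apply/seteqP; split.
  apply: (smallest_sub Ks) => _ [s _ [x kx <-]].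
  by apply: Kinv; exact: Kker.
set V := subrep_span pi ker.
have Vs : closed_subspace V by exact: closed_span_subspace.
(* Conversely, each summand is generated by an eigenvector whose eigenvalue is a root of p, hence by
   a vector of the kernel. *)
apply: (smallest_sub Vs) => x [i _].
have Vc : closed V by case: Vs.
rewrite (iffLR (closure_id V) Vc); apply: closureS => _ [a ga <-].
have [Aa aA] := group_algebra_support ga.
rewrite rep_algE (ga_extE _ aA); apply: (closed_subspace_sum _ Vs) => s _.
apply: (closed_subspaceZ _ Vs); apply: sub_gen_smallest; exists s => //.
by exists (sval i) => //; exact: eigen_ker (ze i) (zr i).
Qed.

End FreeGroup.
End WeakContainment.

Theorem theorem4p5 (R : realType) (n : nat) (hn : (2 <= n)%N)
    (G : groupType) (u : 'I_n -> G) (hG : free_group_on u)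
    (p : {poly R[i]}) (hp : p != 0) :
  let u1 := u (Ordinal (ltnW hn)) in
  (forall psi : G -> R[i], is_state psi -> is_reduced psi ->
     ga_eval psi (ga_mul (ga_star (ga_poly p u1)) (ga_poly p u1)) = 0 ->
     exists (m : nat) (t : 'I_m -> R[i]) (z : 'I_m -> R[i]),
       [/\ forall i, 0 <= t i,
           \sum_(i < m) t i = 1,
           forall i, `|z i| = 1 /\ root p (z i) &
           forall s, psi s = \sum_(i < m) t i * chi u1 (z i) s])
  /\
  (forall (H : hilbert R) (pi : unirep G H),
     weakly_contained pi (regular_rep R G) ->
     (exists2 x : H, x != 0 & rep_alg pi (ga_poly p u1) x = 0) ->
     exists (I : Type) (z : I -> R[i]) (W : I -> set H),
       [/\ forall i, `|z i| = 1 /\ root p (z i),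
           forall i, is_GNS pi (W i) (chi u1 (z i)) &
           is_direct_sum pi
             (subrep_span pi [set x | rep_alg pi (ga_poly p u1) x = 0]) W]).
Proof.
move=> u1; split=> [psi [_ psi1] psi_red psi_null|H pi pi_wc _].
  exact: reduced_state_convex_combination.
exact: weakly_contained_direct_sum.
Qed.
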